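(* Let $R$ be a generically Gorenstein local Cohen--Macaulay ring of dimension $1$ with total ring of fractions $Q(R)$. Let $S$ be a ring with $R\subseteq S\subseteq Q(R)$ such that $S$ is finitely generated as an $R$-module. Then the following are equivalent: (1) $\Omega\operatorname{CM}(S)=\operatorname{CM}(S)\cap\Omega\operatorname{CM}(R)$. (2) $S\cong\operatorname{Hom}_R(S,R)$ as $R$-modules. (3) $S\in\operatorname{Ref}(R)$, and $\mathfrak c_R(S)$ is a stable ideal of $R$. (4) $\Omega\operatorname{CM}(S)=\{M\in\operatorname{Ref}(R):\operatorname{tr}_R(M)\subseteq\mathfrak c_R(S)\}$.
   Context: All rings are commutative and Noetherian, and all modules are finitely generated. A ring is generically Gorenstein if its localizations at all associated primes are Gorenstein. For a ring $A$: $\operatorname{CM}(A)$ is the category of maximal Cohen--Macaulay $A$-modules (modules $M$ with $\operatorname{depth} M_{\mathfrak p}\ge\dim A_{\mathfrak p}$ for all primes $\mathfrak p$, with $\operatorname{depth} 0=\infty$); $\operatorname{Ref}(A)$ is the category of reflexive $A$-modules (the natural map $M\to\operatorname{Hom}_A(\operatorname{Hom}_A(M,A),A)$ is an isomorphism); $\Omega\operatorname{CM}(A)$ is the category of all $A$-modules $M$ for which there is an exact sequence of $A$-modules $0\to M\to P\to N\to 0$ with $P$ projective and $N\in\operatorname{CM}(A)$. The trace ideal of an $R$-module $M$ is $\operatorname{tr}_R(M)=\sum_{f\in\operatorname{Hom}_R(M,R)}f(M)$. The conductor is $\mathfrak c_R(S)=\{a\in Q(R): aS\subseteq R\}$, an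 ideal of both $R$ and $S$. An ideal $I$ of a ring $A$ is regular if it contains a non-zero-divisor of $A$; a regular ideal $I$ is stable if $I\cong\operatorname{Hom}_A(I,I)$ as $A$-modules. $S$-modules are regarded as $R$-modules by restriction of scalars (a torsion-free $R$-module has at most one compatible $S$-module structure, and $R$-linear maps between torsion-free $S$-modules are $S$-linear), and all equalities and intersections of classes of $S$-modules with classes of $R$-modules are understood in this sense, i.e. as (isomorphism-closed) classes of $R$-modules. *)

(* Defs.v *)
From HB Require Import structures.
From mathcomp Require Import all_boot all_algebra ring boolp.

Set Implicit Arguments.
Unset Strict Implicit.
Unset Printing Implicit Defensive.

Import GRing.Theory.
Local Open Scope ring_scope.
Local Open Scope quotient_scope.

Section HomModule.
Variables (A : comPzRingType) (M N : lmodType A).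

HB.instance Definition _ := gen_eqMixin {linear M -> N}.
HB.instance Definition _ := gen_choiceMixin {linear M -> N}.

Lemma lin_ext (f g : {linear M -> N}) : f =1 g -> f = g.
Proof.
move=> fg; have e : f = g :> (M -> N) by apply/funext.
case: f g e {fg} => [f [[cf1] [cf2]]] [g [[cg1] [cg2]]] /= e.
case: g / e cg1 cg2 => cg1 cg2.
by rewrite (Prop_irrelevance cf1 cg1) (Prop_irrelevance cf2 cg2).
Qed.

Definition lin0 : {linear M -> N} := \0.
Definition linN (f : {linear M -> N}) : {linear M -> N} := \- f.
Definition linD (f g : {linear M -> N}) : {linear M -> N} := f \+ g.
Definition linZ (a : A) (f : {linear M -> N}) : {linear M -> N} := a \*: f.

Fact linDA : associative linD.
Proof. by move=> f g h; apply: lin_ext => x /=; rewrite addrA. Qed.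
Fact linDC : commutative linD.
Proof. by move=> f g; apply: lin_ext => x /=; rewrite addrC. Qed.
Fact lin0D : left_id lin0 linD.
Proof. by move=> f; apply: lin_ext => x /=; rewrite add0r. Qed.
Fact linND : left_inverse lin0 linN linD.
Proof. by move=> f; apply: lin_ext => x /=; rewrite addNr. Qed.

HB.instance Definition _ :=
  GRing.isZmodule.Build {linear M -> N} linDA linDC lin0D linND.

Fact linZA a b f : linZ a (linZ b f) = linZ (a * b) f.
Proof. by apply: lin_ext => x /=; rewrite scalerA. Qed.
Fact lin1Z : left_id 1 linZ.
Proof. by move=> f; apply: lin_ext => x /=; rewrite scale1r. Qed.
Fact linZDr : right_distributive linZ +%R.
Proof. by move=> a f g; apply: lin_ext => x /=; rewrite scalerDr. Qed.
Fact linZDl f : {morph linZ^~ f : a b / a + b}.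
Proof. by move=> a b; apply: lin_ext => x /=; rewrite scalerDl. Qed.

HB.instance Definition _ :=
  GRing.Zmodule_isLmodule.Build A {linear M -> N} linZA lin1Z linZDr linZDl.

End HomModule.

Section Bidual.
Variables (A : comPzRingType) (M : lmodType A).

Definition bidual_at (m : M) (f : {linear M -> A^o}) : A^o := f m.

Fact bidual_at_linear m : linear (bidual_at m).
Proof. by move=> a f g. Qed.

HB.instance Definition _ m :=
  GRing.isLinear.Build A {linear M -> A^o} A^o *:%R (bidual_at m)
    (bidual_at_linear m).

Definition bidual (m : M) : {linear {linear M -> A^o} -> A^o} := bidual_at m.

End Bidual.

(* Ideals of A are taken to be submodules of A^o: the structures [idealr] and
   [prime_idealr] of ring_quotient only cover proper ideals. *)
Section Submodule.
Variables (A : comPzRingType) (M : lmodType A) (I : submodClosed M).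

Record submod := Submod { submod_val : M; _ : submod_val \in I }.

HB.instance Definition _ := [isSub for submod_val].
HB.instance Definition _ := [Choice of submod by <:].
HB.instance Definition _ := [SubChoice_isSubLmodule of submod by <:].

End Submodule.

Definition restr (R : comPzRingType) (S : comAlgType R) (N : lmodType S) : Type
  := N.

Section Restriction.
Variables (R : comPzRingType) (S : comAlgType R) (N : lmodType S).

HB.instance Definition _ := GRing.Zmodule.on (restr N).

Definition restr_scale (r : R) (n : restr N) : restr N := (r%:A : S) *: (n : N).

Fact restr_scaleA a b n :
  restr_scale a (restr_scale b n) = restr_scale (a * b) n.
Proof. by rewrite /restr_scale scalerA -scalerAl mul1r scalerA. Qed.
Fact restr_scale1 : left_id 1 restr_scale.
Proof. by move=> n; rewrite /restr_scale !scale1r. Qed.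
Fact restr_scaleDr : right_distributive restr_scale +%R.
Proof. by move=> a m n; rewrite /restr_scale scalerDr. Qed.
Fact restr_scaleDl n : {morph restr_scale^~ n : a b / a + b}.
Proof. by move=> a b; rewrite /restr_scale !scalerDl. Qed.

HB.instance Definition _ := GRing.Zmodule_isLmodule.Build R (restr N)
  restr_scaleA restr_scale1 restr_scaleDr restr_scaleDl.

End Restriction.

HB.mixin Record isZeroFree (A : comNzRingType) (W : A -> bool) := {
  zero_free_subproof : 0 \notin W
}.

(* Multiplicative subsets not containing 0, so that localizing gives a nonzero
   ring. *)
#[short(type="mulSet")]
HB.structure Definition MulSet (A : comNzRingType) :=
  {W of GRing.MulClosed A W & isZeroFree A W}.

Section LocalizedModule.
Variables (A : comNzRingType) (W : mulSet A) (M : lmodType A).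

Definition denom := {s : A | s \in W}.

Definition denom1 : denom := exist _ 1 (rpred1 W).

Fact denomM_subproof (s t : denom) : sval s * sval t \in W.
Proof. by rewrite rpredM ?(svalP s) ?(svalP t). Qed.
Definition denomM (s t : denom) : denom :=
  exist _ (sval s * sval t) (denomM_subproof s t).

Definition loc_rel (x y : M * denom) : bool :=
  `[< exists2 t, t \in W & t *: (sval y.2 *: x.1) = t *: (sval x.2 *: y.1) >].

Fact loc_rel_refl : reflexive loc_rel.
Proof. by move=> x; apply/asboolP; exists 1; rewrite ?rpred1. Qed.

Fact loc_rel_sym : symmetric loc_rel.
Proof.
by move=> x y; apply/asboolP/asboolP => -[t tW e]; exists t.
Qed.

Fact loc_rel_trans : transitive loc_rel.
Proof.
move=> [y [s sW]] [x [r rW]] [z [q qW]] /asboolP[/= t tW e1].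
move=> /asboolP[/= u uW e2].
apply/asboolP; exists (t * u * s); first by rewrite !rpredM.
transitivity ((u * q) *: (t *: (s *: x))) => /=.
  by rewrite !scalerA; congr (_ *: _); ring.
rewrite e1; transitivity ((t * r) *: (u *: (q *: y))).
  by rewrite !scalerA; congr (_ *: _); ring.
by rewrite e2 !scalerA; congr (_ *: _); ring.
Qed.

Canonical loc_equiv := EquivRel loc_rel loc_rel_refl loc_rel_sym loc_rel_trans.

Definition loc : Type := {eq_quot loc_equiv}.

HB.instance Definition _ := Choice.on loc.

Definition frac (m : M) (s : denom) : loc := \pi_({eq_quot loc_equiv}) (m, s).

Lemma eq_frac m s m' s' :
  frac m s = frac m' s' <->
  exists2 t, t \in W & t *: (sval s' *: m) = t *: (sval s *: m').
Proof.
split=> [/eqP|h]; last by apply/eqP; rewrite eqmodE; apply/asboolP.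
by rewrite eqmodE => /asboolP.
Qed.

Lemma fracP (x : loc) : exists m s, x = frac m s.
Proof.
by exists (repr (x : {eq_quot loc_equiv})).1, (repr (x : {eq_quot loc_equiv})).2;
  rewrite /frac -surjective_pairing reprK.
Qed.

Definition loc_repr (x : loc) : M * denom := repr (x : {eq_quot loc_equiv}).

Lemma loc_reprP m s : exists2 t, t \in W &
  t *: (sval s *: (loc_repr (frac m s)).1)
  = t *: (sval (loc_repr (frac m s)).2 *: m).
Proof.
by apply/eq_frac; rewrite /frac -surjective_pairing reprK.
Qed.

Definition loc0 : loc := frac 0 denom1.
Definition locN (x : loc) : loc := frac (- (loc_repr x).1) (loc_repr x).2.
Definition locD (x y : loc) : loc :=
  frac (sval (loc_repr y).2 *: (loc_repr x).1
        + sval (loc_repr x).2 *: (loc_repr y).1)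
       (denomM (loc_repr x).2 (loc_repr y).2).

Lemma locNE m s : locN (frac m s) = frac (- m) s.
Proof.
apply/eq_frac; have [t tW e] := loc_reprP m s.
by exists t; rewrite // !scalerN e.
Qed.

Lemma locDE m s n t :
  locD (frac m s) (frac n t) = frac (sval t *: m + sval s *: n) (denomM s t).
Proof.
apply/eq_frac; have [u uW eu] := loc_reprP m s; have [v vW ev] := loc_reprP n t.
case: (loc_repr (frac m s)) eu => m' s' /= eu.
case: (loc_repr (frac n t)) ev => n' t' /= ev.
exists (u * v); first by rewrite rpredM.
rewrite !scalerDr; congr (_ + _).
  transitivity ((v * sval t * sval t') *: (u *: (sval s *: m'))).
    by rewrite !scalerA; congr (_ *: _); ring.
  by rewrite eu !scalerA; congr (_ *: _); ring.
transitivity ((u * sval s * sval s') *: (v *: (sval t *: n'))).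
  by rewrite !scalerA; congr (_ *: _); ring.
by rewrite ev !scalerA; congr (_ *: _); ring.
Qed.

Lemma frac_eq m s m' s' : sval s' *: m = sval s *: m' -> frac m s = frac m' s'.
Proof. by move=> e; apply/eq_frac; exists 1; rewrite ?rpred1 ?e. Qed.

Fact locDA : associative locD.
Proof.
move=> x y z; have [m [s ->]] := fracP x; have [n [t ->]] := fracP y.
have [k [u ->]] := fracP z; rewrite !locDE; apply: frac_eq => /=.
rewrite !scalerDr !scalerA !addrA.
by congr (_ *: _ + _ *: _ + _ *: _); ring.
Qed.

Fact locDC : commutative locD.
Proof.
move=> x y; have [m [s ->]] := fracP x; have [n [t ->]] := fracP y.
rewrite !locDE; apply: frac_eq => /=.
by rewrite addrC [sval s * sval t]mulrC.
Qed.

Fact loc0D : left_id loc0 locD.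
Proof.
move=> x; have [m [s ->]] := fracP x; rewrite locDE; apply: frac_eq => /=.
by rewrite scaler0 add0r scale1r mul1r.
Qed.

Fact locND : left_inverse loc0 locN locD.
Proof.
move=> x; have [m [s ->]] := fracP x; rewrite locNE locDE; apply: frac_eq => /=.
by rewrite !scaler0 -scalerDr addNr !scaler0.
Qed.

HB.instance Definition _ := GRing.isZmodule.Build loc locDA locDC loc0D locND.

End LocalizedModule.

Section LocalizedAction.
Variables (A : comNzRingType) (W : mulSet A) (M : lmodType A).

Definition loc_act (a : loc W A^o) (x : loc W M) : loc W M :=
  frac (((loc_repr a).1 : A) *: (loc_repr x).1)
       (denomM (loc_repr a).2 (loc_repr x).2).

Lemma loc_actE (a : A) s m t :
  loc_act (frac (a : A^o) s) (frac m t) = frac (a *: m) (denomM s t).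
Proof.
apply/eq_frac; have [u uW eu] := @loc_reprP A W A^o (a : A^o) s.
have [v vW ev] := loc_reprP m t.
case: (loc_repr (frac (a : A^o) s)) eu => a' s' /= eu.
case: (loc_repr (frac m t)) ev => m' t' /= ev.
exists (u * v); first by rewrite rpredM.
transitivity ((u * (sval s * a')) *: (v *: (sval t *: m'))).
  by rewrite !scalerA; congr (_ *: _); ring.
rewrite ev; have -> : u * (sval s * a') = u * (sval s' * a) by exact: eu.
by rewrite !scalerA; congr (_ *: _); ring.
Qed.

End LocalizedAction.

Section LocalizedRing.
Variables (A : comNzRingType) (W : mulSet A).

Definition loc_ring : Type := loc W A^o.

HB.instance Definition _ := GRing.Zmodule.on loc_ring.

Definition rfrac (a : A) (s : denom W) : loc_ring := @frac A W A^o a s.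

Definition loc_one : loc_ring := rfrac 1 (denom1 W).
Definition loc_mul : loc_ring -> loc_ring -> loc_ring := @loc_act A W A^o.

Let ringP (x : loc_ring) : exists (a : A) s, x = rfrac a s.
Proof. exact: (@fracP A W A^o x). Qed.
Let ring_eq (a b : A) s t : sval t * a = sval s * b ->
  rfrac a s = rfrac b t.
Proof. exact: (@frac_eq A W A^o). Qed.

Lemma loc_mulE (a b : A) s t :
  loc_mul (rfrac a s) (rfrac b t)
  = rfrac (a * b) (denomM s t).
Proof. exact: (@loc_actE A W _). Qed.

Let addE (a b : A) s t :
  rfrac a s + rfrac b t
  = rfrac (sval t * a + sval s * b) (denomM s t).
Proof. exact: (@locDE A W _). Qed.

Fact loc_mulA : associative loc_mul.
Proof.
move=> x y z; have [a [s ->]] := ringP x; have [b [t ->]] := ringP y.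
have [c [u ->]] := ringP z; rewrite !loc_mulE; apply: ring_eq => /=; ring.
Qed.

Fact loc_mulC : commutative loc_mul.
Proof.
move=> x y; have [a [s ->]] := ringP x; have [b [t ->]] := ringP y.
by rewrite !loc_mulE; apply: ring_eq => /=; ring.
Qed.

Fact loc_mul1 : left_id loc_one loc_mul.
Proof.
move=> x; have [a [s ->]] := ringP x.
by rewrite /loc_one loc_mulE; apply: ring_eq => /=; ring.
Qed.

Fact loc_mulDl : left_distributive loc_mul +%R.
Proof.
move=> x y z; have [a [s ->]] := ringP x; have [b [t ->]] := ringP y.
have [c [u ->]] := ringP z; rewrite addE !loc_mulE addE.
by apply: ring_eq => /=; ring.
Qed.

Fact loc_one_neq0 : loc_one != 0.
Proof.
apply/eqP => /eq_frac[t tW]; rewrite /= !scale1r scaler0 => t0.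
have := @zero_free_subproof _ W; apply/negP; rewrite negbK.
by move: t0; rewrite /GRing.scale /= mulr1 => <-.
Qed.

HB.instance Definition _ := GRing.Zmodule_isComNzRing.Build loc_ring
  loc_mulA loc_mulC loc_mul1 loc_mulDl loc_one_neq0.

Definition to_loc (a : A) : loc_ring := rfrac a (denom1 W).

Fact to_loc_zmod_morphism : zmod_morphism to_loc.
Proof.
move=> a b; apply: (addIr (to_loc b)); rewrite subrK addE.
by apply: ring_eq => /=; ring.
Qed.

Fact to_loc_monoid_morphism : monoid_morphism to_loc.
Proof.
split=> // a b; rewrite [RHS]loc_mulE.
by apply: ring_eq => /=; ring.
Qed.

HB.instance Definition _ :=
  GRing.isZmodMorphism.Build A loc_ring to_loc to_loc_zmod_morphism.
HB.instance Definition _ :=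
  GRing.isMonoidMorphism.Build A loc_ring to_loc to_loc_monoid_morphism.

End LocalizedRing.

Section LocalizedLmodule.
Variables (A : comNzRingType) (W : mulSet A) (M : lmodType A).

Definition loc_scale : loc_ring W -> loc W M -> loc W M := @loc_act A W M.

Let ringP (x : loc_ring W) : exists (a : A) s, x = rfrac a s.
Proof. exact: (@fracP A W A^o x). Qed.

Lemma loc_scaleE (a : A) (m : M) s t :
  loc_scale (rfrac a s) (frac m t) = frac (a *: m) (denomM s t).
Proof. exact: (@loc_actE A W _). Qed.

Let addE (m n : M) s t : (frac m s : loc W M) + frac n t
  = frac (sval t *: m + sval s *: n) (denomM s t).
Proof. exact: (@locDE A W _). Qed.

Fact loc_scaleA a b x : loc_scale a (loc_scale b x) = loc_scale (a * b) x.
Proof.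
have [m [s ->]] := ringP a; have [n [t ->]] := ringP b.
have [k [u ->]] := fracP x.
have -> : rfrac m s * rfrac n t
  = rfrac (m * n) (denomM s t) by exact: loc_mulE.
rewrite !loc_scaleE; apply: frac_eq => /=; rewrite !scalerA.
by congr (_ *: _); ring.
Qed.

Fact loc_scale1 : left_id 1 loc_scale.
Proof.
move=> x; have [k [u ->]] := fracP x.
have -> : 1 = rfrac 1 (denom1 W) :> loc_ring W by [].
by rewrite loc_scaleE; apply: frac_eq => /=; rewrite scale1r mul1r.
Qed.

Fact loc_scaleDr : right_distributive loc_scale +%R.
Proof.
move=> a x y; have [m [s ->]] := ringP a; have [n [t ->]] := fracP x.
have [k [u ->]] := fracP y; rewrite addE !loc_scaleE addE.
apply: frac_eq => /=; rewrite !scalerDr !scalerA.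
by congr (_ *: _ + _ *: _); ring.
Qed.

Fact loc_scaleDl x : {morph loc_scale^~ x : a b / a + b}.
Proof.
move=> a b; have [m [s ->]] := ringP a; have [n [t ->]] := ringP b.
have [k [u ->]] := fracP x.
have -> : rfrac m s + rfrac n t
  = rfrac (sval t * m + sval s * n) (denomM s t) by exact: locDE.
rewrite !loc_scaleE addE; apply: frac_eq => /=.
rewrite !scalerA -scalerDl !scalerA.
by congr (_ *: _); ring.
Qed.

HB.instance Definition _ := GRing.Zmodule_isLmodule.Build (loc_ring W) (loc W M)
  loc_scaleA loc_scale1 loc_scaleDr loc_scaleDl.

End LocalizedLmodule.

Section PrimeComplement.
Variables (A : comNzRingType) (p : prime_idealr A).

Definition prime_compl (a : A) : bool := a \notin p.

Fact prime_compl_mul_closed : GRing.mulr_closed prime_compl.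
Proof.
split=> [|a b]; rewrite ![_ \in prime_compl]unfold_in /prime_compl ?idealr1 //.
by rewrite prime_idealrM negb_or => -> ->.
Qed.
Fact prime_compl_zero_free : 0 \notin prime_compl.
Proof. by rewrite [_ \in prime_compl]unfold_in /prime_compl idealr0. Qed.

HB.instance Definition _ :=
  GRing.isMulClosed.Build A prime_compl prime_compl_mul_closed.
HB.instance Definition _ := isZeroFree.Build A prime_compl prime_compl_zero_free.

Definition prime_mulset : mulSet A := MulSet.clone A prime_compl _.

End PrimeComplement.

Notation ring_at p := (loc_ring (prime_mulset p)).
Notation module_at p M := (loc (prime_mulset p) M).

(* In a commutative ring, [GRing.lreg a] says that a is a non-zero-divisor. *)
Section TotalFractions.
Variable A : comNzRingType.

Definition nonzerodiv (a : A) : bool := `[< GRing.lreg a >].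

Fact nonzerodiv_mul_closed : GRing.mulr_closed nonzerodiv.
Proof.
split=> [|a b]; rewrite !unfold_in; first by apply/asboolP; exact: lreg1.
by move=> /asboolP a_reg /asboolP b_reg; apply/asboolP; exact: lregM.
Qed.
Fact nonzerodiv_zero_free : 0 \notin nonzerodiv.
Proof.
rewrite unfold_in; apply/asboolP => /(_ 1 0); rewrite !mul0r => /(_ erefl).
by apply/eqP; rewrite oner_neq0.
Qed.

HB.instance Definition _ :=
  GRing.isMulClosed.Build A nonzerodiv nonzerodiv_mul_closed.
HB.instance Definition _ := isZeroFree.Build A nonzerodiv nonzerodiv_zero_free.

Definition nonzerodiv_mulset : mulSet A := MulSet.clone A nonzerodiv _.

End TotalFractions.

Notation total_frac A := (loc_ring (nonzerodiv_mulset A)).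
Notation to_total_frac A := (@to_loc A (nonzerodiv_mulset A)).

Section Modules.
Variable A : comNzRingType.
Implicit Types M N P E : lmodType A.

Definition mod_iso M N := exists f : {linear M -> N}, bijective f.

Definition fin_gen M :=
  exists n (g : 'I_n -> M), forall m, exists c : 'I_n -> A,
    m = \sum_i c i *: g i.

Definition noetherian := forall I : submodClosed A^o, fin_gen (submod I).

Definition short_exact M P N (f : {linear M -> P}) (g : {linear P -> N}) :=
  [/\ injective f, (forall p, g p = 0 <-> exists m, p = f m)
    & forall n, exists p, n = g p].

Definition projective P :=
  forall M N (g : {linear M -> N}) (h : {linear P -> N}),
    (forall n, exists m, n = g m) ->
    exists h' : {linear P -> M}, forall p, g (h' p) = h p.

Definition injective_module E :=
  forall M N (f : {linear M -> N}) (h : {linear M -> E}), injective f ->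
    exists h' : {linear N -> E}, forall m, h' (f m) = h m.

(* M has an injective resolution of length at most n. *)
Fixpoint injdim_le n M : Prop :=
  if n is k.+1 then
    exists (E C : lmodType A) (f : {linear M -> E}) (g : {linear E -> C}),
      [/\ injective_module E, short_exact f g & injdim_le k C]
  else injective_module M.

Definition is_reflexive M := fin_gen M /\ bijective (@bidual A M).

Definition trace M (a : A) :=
  exists n (f : 'I_n -> {linear M -> A^o}) (m : 'I_n -> M),
    a = \sum_i f i (m i).

Definition regular_ideal (I : submodClosed A^o) :=
  exists2 a : A, (a : A^o) \in I & GRing.lreg a.

Definition stable_ideal (I : submodClosed A^o) :=
  regular_ideal I /\ mod_iso (submod I) {linear submod I -> submod I}.

Definition maximal_ideal (m : idealr A) :=
  forall J : idealr A, {subset m <= J} -> {subset J <= m}.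

Definition is_local :=
  exists2 m : idealr A, maximal_ideal m
    & forall m' : idealr A, maximal_ideal m' -> m' =i m.

Definition krull_dim_ge n :=
  exists p : nat -> prime_idealr A, forall i, (i < n)%N ->
    {subset p i <= p i.+1} /\ ~ {subset p i.+1 <= p i}.

Definition krull_dim_eq n := krull_dim_ge n /\ ~ krull_dim_ge n.+1.

Definition in_seq_mul (xs : seq A) M (m : M) :=
  exists c : nat -> M, m = \sum_(i < size xs) xs`_i *: c i.

(* The second clause says that M / xs M is nonzero. *)
Definition regular_seq M (xs : seq A) :=
  (forall i, (i < size xs)%N -> forall m : M,
     in_seq_mul (take i xs) (xs`_i *: m) -> in_seq_mul (take i xs) m)
  /\ exists m : M, ~ in_seq_mul xs m.

(* depth M >= n, for a finitely generated module over a Noetherian local ring;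
   the first disjunct is the convention depth 0 = oo. *)
Definition depth_ge M n :=
  (forall m : M, m = 0) \/
  exists2 p : idealr A, maximal_ideal p
    & exists xs : seq A, [/\ size xs = n, {subset xs <= p} & regular_seq M xs].

Definition cm_local_ring := [/\ noetherian, is_local
  & forall n, depth_ge A^o n <-> krull_dim_ge n].

Definition gorenstein_local_ring := [/\ noetherian, is_local
  & exists n, injdim_le n A^o].

Definition associated_prime (p : prime_idealr A) :=
  exists x : A, forall a, a \in p <-> a * x = 0.

End Modules.

Definition generically_gorenstein (A : comNzRingType) :=
  forall p : prime_idealr A, associated_prime p ->
    gorenstein_local_ring (ring_at p).

(* depth M_p >= dim A_p is read as: every n <= dim A_p satisfies n <= depth M_p. *)
Definition MCM (A : comNzRingType) (M : lmodType A) :=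
  fin_gen M /\
  forall (p : prime_idealr A) n,
    krull_dim_ge (ring_at p) n -> depth_ge (module_at p M) n.

Definition Omega_CM (A : comNzRingType) (M : lmodType A) :=
  fin_gen M /\
  exists (P N : lmodType A) (f : {linear M -> P}) (g : {linear P -> N}),
    [/\ fin_gen P, projective P, MCM N & short_exact f g].

Section BirationalExtension.
Variables (R : comNzRingType) (S : comAlgType R).

(* A class C of S-modules seen as an isomorphism-closed class of R-modules. *)
Definition restr_class (C : lmodType S -> Prop) (M : lmodType R) :=
  exists N : lmodType S, C N /\ mod_iso (restr N) M.

Variable j : {rmorphism S -> total_frac R}.

Definition conductor (a : total_frac R) :=
  forall s : S, exists r : R, a * j s = to_total_frac R r.

(* Every element of [conductor] is of the form r/1, as j 1 = 1. *)
Definition in_conductor (r : R^o) : bool := `[< conductor (to_total_frac R r) >].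

Fact in_conductor_closed : GRing.subsemimod_closed in_conductor.
Proof.
split; first split.
- by apply/asboolP => s; exists 0; rewrite [to_loc _ _]rmorph0 mul0r.
- move=> a b /asboolP aP /asboolP bP; apply/asboolP => s.
  have [r er] := aP s; have [q eq] := bP s.
  exists (r + q); rewrite [RHS]rmorphD /= -er -eq -mulrDl.
  by congr (_ * _); exact: rmorphD.
- move=> a b /asboolP bP; apply/asboolP => s; have [r er] := bP s.
  exists (a * r); rewrite [RHS]rmorphM /= -er mulrA.
  by congr (_ * _); exact: rmorphM.
Qed.

HB.instance Definition _ :=
  GRing.isSubmodClosed.Build R R^o in_conductor in_conductor_closed.

Definition conductor_ideal : submodClosed R^o :=
  GRing.SubmodClosed.clone R R^o in_conductor _.

End BirationalExtension.

(* Main.v *)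
(* Modules are compared over R itself: an S-module that is torsion-free over R
   is controlled by its R-linear functionals, because every s in S satisfies
   x^e s in R for a fixed non-zero-divisor x.  Three inputs drive the proof.
   - R_q is self-injective for each minimal prime q (over an Artinian local
     ring finite injective dimension is zero), so partially defined functionals
     extend up to a power of x.  Hence torsion-free modules are torsionless, and
     a submodule of a reflexive module with torsion-free cokernel is reflexive;
     in particular Omega CM(R) = Ref(R).
   - Over R and S, maximal Cohen-Macaulay means finitely generated and
     torsion-free.
   - All four conditions say that the conductor C is free of rank one over S.
     The delicate step starts from C in Omega CM(S) with S in Ref(R).  Let J be
     the ideal generated by the values on C of the functionals that extend to
     the projective overmodule.  From S : J = S and depth S = 1 one gets J = S,
     so C is invertible, hence principal as S is semilocal.  *)
Require Import Defs.
From HB Require Import structures.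
From mathcomp Require Import all_boot all_algebra ring boolp.
Set Implicit Arguments.
Unset Strict Implicit.
Unset Printing Implicit Defensive.
Import GRing.Theory.
Local Open Scope ring_scope.

(** * Submodules, primes and quotients over a Noetherian ring *)

(** The first condition is used at two modules only: at S, which yields S in Ref(R), and at C. The
    latter qualifies because it is torsion-free over S and, being Hom_R(S, R) under f |-> f(1),
    reflexive over R; this is how C enters Omega CM(S). Under the same identification an isomorphism
    of S with its dual amounts to a generator of C. Traces enter because every functional on an
    S-module takes values in C. Linearity over S is recovered from linearity over R: multiplication
    by x^e carries S into R and is injective on the modules compared. The Gorenstein hypothesis
    concerns localizations, whereas functionals are needed on R-modules. The bridge is the ideal of
    denominators d for which d times a given partial functional extends: if it contained no power of
    x, it would lie in a minimal prime q, yet extension at q supplies a denominator outside q. The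
    semilocal argument does not list maximal ideals: strong pi-regularity of S / mS glues finitely
    many functionals into one. *)

Section Submodules.
Variables (A : comNzRingType).
Implicit Types M N : lmodType A.

Definition is_sub M (K : M -> Prop) :=
  [/\ K 0, forall m n, K m -> K n -> K (m + n) & forall a m, K m -> K (a *: m)].

(** An intersection of submodules: a property is proved on a span by exhibiting it as a submodule
    that contains the generators. *)
Definition in_span M (s : seq M) (m : M) :=
  forall L : M -> Prop, is_sub L -> (forall g, g \in s -> L g) -> L m.

Definition fg_sub M (K : M -> Prop) :=
  exists s : seq M, (forall g, g \in s -> K g) /\ forall m, K m -> in_span s m.

Lemma subN M (K : M -> Prop) m : is_sub K -> K m -> K (- m).
Proof. by case=> _ _ h /(h (-1)); rewrite scaleN1r. Qed.

Lemma subB M (K : M -> Prop) m n : is_sub K -> K m -> K n -> K (m - n).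
Proof. by move=> Ks Km /(subN Ks); case: Ks => _ h _; apply: h. Qed.

Lemma sub_sum M (K : M -> Prop) n (c : 'I_n -> A) (g : 'I_n -> M) :
  is_sub K -> (forall i, K (g i)) -> K (\sum_i c i *: g i).
Proof.
by case=> K0 KD KZ Kg; elim/big_ind: _ => // i _; apply/KZ/Kg.
Qed.

Section ToSubmod.
Variables (M : lmodType A) (K : M -> Prop) (Ks : is_sub K).

Definition sub_pred : M -> bool := let _ := Ks in fun m => `[< K m >].

Fact sub_pred_closed : GRing.subsemimod_closed sub_pred.
Proof.
case: (Ks) => K0 KD KZ; split; first split; first exact/asboolP.
- by move=> m n /asboolP Km /asboolP Kn; apply/asboolP/KD.
- by move=> a m /asboolP Km; apply/asboolP/KZ.
Qed.

HB.instance Definition _ :=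
  GRing.isSubmodClosed.Build A M sub_pred sub_pred_closed.

Definition to_submod : submodClosed M := GRing.SubmodClosed.clone A M sub_pred _.

Lemma to_submodP m : reflect (K m) (m \in to_submod).
Proof. exact: asboolP. Qed.

End ToSubmod.

Lemma in_span_sub M (s : seq M) : is_sub (in_span s).
Proof.
split=> [L [L0 _ _] _|m n sm sn L Ls sL|a m sm L Ls sL]; first exact: L0.
  by case: (Ls) => _ LD _; apply: LD; [apply: sm|apply: sn].
by case: (Ls) => _ _ LZ; apply: LZ; apply: sm.
Qed.

Lemma in_span_gen M (s : seq M) g : g \in s -> in_span s g.
Proof. by move=> gs L _; apply. Qed.

Lemma in_span_sum M n (g : 'I_n -> M) m :
  (exists c : 'I_n -> A, m = \sum_i c i *: g i) <-> in_span (codom g) m.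
Proof.
split=> [[c ->]|].
  apply: sub_sum (in_span_sub _) _ => i; apply: in_span_gen; exact: codom_f.
move/(_ (fun m => exists c : 'I_n -> A, m = \sum_i c i *: g i)); apply.
  split=> [|_ _ [c ->] [d ->]|a _ [c ->]].
  - by exists (fun=> 0); rewrite big1 // => i _; rewrite scale0r.
  - exists (fun i => c i + d i); rewrite -big_split.
    by apply: eq_bigr => i _; rewrite scalerDl.
  - exists (fun i => a * c i); rewrite scaler_sumr.
    by apply: eq_bigr => i _; rewrite scalerA.
move=> _ /codomP[i ->]; exists (fun j => (j == i)%:R).
rewrite (bigD1 i) //= eqxx scale1r big1 ?addr0 // => k /negPf->.
by rewrite scale0r.
Qed.

Lemma in_span_cons M g (s : seq M) m :
  in_span (g :: s) m -> exists a, in_span s (m - a *: g).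
Proof.
move/(_ (fun m => exists a, in_span s (m - a *: g))); apply=> [|h]; last first.
  rewrite inE => /predU1P[->|hs].
    by exists 1; rewrite scale1r subrr; case: (in_span_sub s).
  by exists 0; rewrite scale0r subr0; apply: in_span_gen.
have [s0 sD sZ] := in_span_sub s.
split=> [|x y [a ha] [b hb]|b x [a ha]].
- by exists 0; rewrite scale0r subr0.
- by exists (a + b); rewrite scalerDl opprD addrACA; apply: sD.
- by exists (b * a); rewrite -scalerA -scalerBr; apply: sZ.
Qed.

Lemma fin_genP M : fin_gen M <-> exists s : seq M, forall m, in_span s m.
Proof.
split=> [[n [g gP]]|[s sP]].
  by exists (codom g) => m; apply/in_span_sum.
exists (size s), (fun i => s`_i) => m; apply/in_span_sum.
suff -> : codom (fun i : 'I_(size s) => s`_i) = s by [].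
by rewrite codomE /= -[in RHS](@mkseq_nth M 0 s) /mkseq -val_enum_ord -map_comp.
Qed.

Lemma noetherian_fg (I : A^o -> Prop) : noetherian A -> is_sub I -> fg_sub I.
Proof.
move=> nA Is; have [n [g gP]] := nA (to_submod Is).
exists (codom (fun i => val (g i))); split=> [_ /codomP[i ->]|m Im].
  exact/(to_submodP Is)/valP.
have mI : m \in to_submod Is by exact/to_submodP.
apply/in_span_sum; have [c e] := gP (Submod mI); exists c.
by rewrite -[m]/(val (Submod mI)) e raddf_sum.
Qed.

(** Induction on the ambient generators: lifts of generators of the ideal of coefficients along [g],
    together with generators of the part of [K] inside the span of [s], generate [K]. *)
Lemma in_span_fg M (s : seq M) (K : M -> Prop) : noetherian A ->
  is_sub K -> (forall m, K m -> in_span s m) -> fg_sub K.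
Proof.
move=> nA; elim: s K => [|g s IHs] K Ks Kspan.
  by exists [::]; split=> // m /Kspan.
have [K0 KD KZ] := Ks; have [s0 sD sZ] := in_span_sub s.
have sN m := @subN M _ m (in_span_sub s).
pose wit a k := K k /\ in_span s (k - a *: g).
pose I (a : A^o) := exists k, wit a k.
have Is : is_sub I.
  split=> [|a b [k [Kk ak]] [l [Kl bl]]|b a [k [Kk ak]]].
  - by exists 0; split=> //; rewrite scale0r subr0.
  - exists (k + l); split; first exact: KD.
    by rewrite scalerDl opprD addrACA; apply: sD.
  - exists (b *: k); split; first exact: KZ.
    by rewrite -scalerA -scalerBr; apply: sZ.
have [sI [sII Ispan]] := noetherian_fg nA Is.
have /choice[w wP] : forall a : A^o, exists k, I a -> wit a k.
  move=> a; have [[k ak]|nI] := pselect (I a); first by exists k.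
  by exists 0 => /nI.
pose K' m := K m /\ in_span s m.
have K's : is_sub K'.
  by split=> [|m n [Km sm] [Kn sn]|a m [Km sm]]; split=> //; auto.
have [s' [s'K' K'in_span]] := IHs K' K's (fun m Km => Km.2).
exists (map w sI ++ s'); split=> [h|m Km L Ls sL].
  rewrite mem_cat => /orP[/mapP[a /sII Ia ->]|/s'K'[] //].
  by have [] := wP a Ia.
have [a sa] := in_span_cons (Kspan m Km).
have Ia : I a by exists m.
have [L0 LD LZ] := Ls.
have [||k [Lk [Kk ak]]] := Ispan a Ia (fun a => exists k, L k /\ wit a k).
- split=> [|x y [k [Lk [Kk ak]]] [l [Ll [Kl bl]]]|y x [k [Lk [Kk ak]]]].
  + by exists 0; do !split=> //; rewrite scale0r subr0.
  + exists (k + l); do !split; [exact: LD|exact: KD|].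
    by rewrite scalerDl opprD addrACA; apply: sD.
  + exists (y *: k); do !split; [exact: LZ|exact: KZ|].
    by rewrite -scalerA -scalerBr; apply: sZ.
- move=> x xI; exists (w x); split; last exact/wP/sII.
  by apply: sL; rewrite mem_cat map_f.
rewrite -[m](subrK k); apply: LD => //; apply: K'in_span => //.
  split; first exact: subB.
  rewrite -[m](subrK (a *: g)) -addrA; apply: sD => //.
  by rewrite -opprB; apply: sN.
by move=> h hs'; apply: sL; rewrite mem_cat hs' orbT.
Qed.

Lemma sub_fg M (K : M -> Prop) : noetherian A -> fin_gen M ->
  is_sub K -> fg_sub K.
Proof.
by move=> nA /fin_genP[s sP] Ks; apply: (in_span_fg (s := s)).
Qed.

(** Without a maximal member, choice gives a strictly increasing chain; its union is finitely
    generated, hence already reached at a finite stage. *)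
Lemma noetherian_max M (F : (M -> Prop) -> Prop) (K0 : M -> Prop) :
  noetherian A -> fin_gen M -> (forall K, F K -> is_sub K) -> F K0 ->
  exists2 K, F K & forall K', F K' -> (forall m, K m -> K' m) ->
    forall m, K' m -> K m.
Proof.
move=> nA Mfg Fs FK0; apply: contrapT => noK.
have step (K : {K | F K}) : exists K' : {K | F K},
    (forall m, sval K m -> sval K' m) /\ ~ forall m, sval K' m -> sval K m.
  apply: contrapT => nK; apply: noK; exists (sval K); first exact: svalP.
  move=> K' FK' KK'; apply: contrapT => nK'; apply: nK.
  by exists (exist _ K' FK').
have [f fP] := choice step.
pose u n := iter n f (exist _ K0 FK0).
have uS n := (fP (u n)).1; have uN n := (fP (u n)).2.
have us n : is_sub (sval (u n)) by exact/Fs/svalP.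
have umono m n x : (m <= n)%N -> sval (u m) x -> sval (u n) x.
  move=> mn ux; rewrite -(subnK mn); elim: (n - m)%N => //= k IHk.
  exact: uS.
pose U x := exists n, sval (u n) x.
have Us : is_sub U.
  split=> [|x y [n ux] [p uy]|a x [n ux]].
  - by exists 0%N; case: (us 0%N).
  - exists (maxn n p); case: (us (maxn n p)) => _ uD _; apply: uD.
      by apply: umono ux; rewrite leq_maxl.
    by apply: umono uy; rewrite leq_maxr.
  - by exists n; case: (us n) => _ _; apply.
have [s [sU Uspan]] := sub_fg nA Mfg Us.
have [k sk] : exists k, forall g, g \in s -> sval (u k) g.
  elim: s sU {Uspan} => [|g s IHs] sU; first by exists 0%N.
  have [|k sk] := IHs; first by move=> h hs; apply: sU; rewrite inE hs orbT.
  have [p up] := sU g (mem_head _ _); exists (maxn k p) => h.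
  rewrite inE => /predU1P[->|/sk ux].
    by apply: umono up; rewrite leq_maxr.
  by apply: umono ux; rewrite leq_maxl.
apply: (uN k) => x ux; apply: Uspan sk => //.
by exists k.+1.
Qed.

Definition adjoin M (K : M -> Prop) (g m : M) := exists a, K (m - a *: g).

Lemma adjoin_sub M (K : M -> Prop) g : is_sub K -> is_sub (adjoin K g).
Proof.
case=> K0 KD KZ; split=> [|x y [a ha] [b hb]|b x [a ha]].
- by exists 0; rewrite scale0r subr0.
- by exists (a + b); rewrite scalerDl opprD addrACA; apply: KD.
- by exists (b * a); rewrite -scalerA -scalerBr; apply: KZ.
Qed.

Lemma adjoin_incl M (K : M -> Prop) g m : K m -> adjoin K g m.
Proof. by move=> Km; exists 0; rewrite scale0r subr0. Qed.

Lemma adjoin_gen M (K : M -> Prop) g : is_sub K -> adjoin K g g.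
Proof. by case=> K0 _ _; exists 1; rewrite scale1r subrr. Qed.

Definition is_prime (P : A^o -> Prop) :=
  [/\ is_sub P, ~ P 1 & forall a b : A, P (a * b) -> P a \/ P b].

Lemma prime_mul_closed (P : A^o -> Prop) (a b : A) :
  is_prime P -> ~ P a -> ~ P b -> ~ P (a * b).
Proof. by case=> _ _ PM na nb /PM[]. Qed.

Lemma prime_exp (P : A^o -> Prop) (a : A) n : is_prime P -> P (a ^+ n) -> P a.
Proof.
case=> _ P1 PM; elim: n => [/P1//|n IHn].
by rewrite exprS => /PM[].
Qed.

Lemma ideal_mull (I : A^o -> Prop) (a b : A) : is_sub I -> I b -> I (a * b).
Proof. by case=> _ _ IZ Ib; apply: (IZ a b). Qed.

Lemma ideal_mulr (I : A^o -> Prop) (a b : A) : is_sub I -> I a -> I (a * b).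
Proof. by rewrite mulrC; apply: ideal_mull. Qed.

Lemma regular_fin_gen : @fin_gen A A^o.
Proof.
exists 1%N, (fun=> 1) => m; exists (fun=> m).
by rewrite big_ord1 /GRing.scale /= mulr1.
Qed.

(** Krull's lemma: an ideal maximal among those that contain [I] and miss [W] is prime, because two
    elements outside it give two elements of [W], whose product would lie in the ideal if the
    product of the two elements did. *)
Lemma prime_avoidance (I W : A^o -> Prop) : noetherian A -> is_sub I ->
  W 1 -> (forall a b : A, W a -> W b -> W (a * b)) ->
  (forall a, I a -> ~ W a) ->
  exists P, [/\ is_prime P, forall a, I a -> P a & forall a, P a -> ~ W a].
Proof.
move=> nA Is W1 WM IW.
pose F J := [/\ is_sub J, forall a, I a -> J a & forall a, J a -> ~ W a].
have [|//|P [Ps IP PW] Pmax] := noetherian_max (F := F) (K0 := I) nA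
  regular_fin_gen; first by move=> J [].
have meet a : ~ P a -> exists p r, P p /\ W (p + r * a).
  move=> nPa; apply: contrapT => nW; apply: nPa.
  apply: (Pmax (adjoin P a)); [split| |].
  - exact: adjoin_sub.
  - by move=> b /IP; apply: adjoin_incl.
  - move=> b [r Pb] Wb; apply: nW; exists (b - r *: a), r; split=> //.
    by rewrite subrK.
  - by move=> b; apply: adjoin_incl.
  - exact: adjoin_gen.
exists P; split=> //; split=> // [P1|a b Pab]; first exact: PW P1 W1.
apply: contrapT => /not_orP[/meet[p [r [Pp Wp]]] /meet[q [u [Pq Wq]]]].
apply: PW (WM _ _ Wp Wq); rewrite mulrDl.
have [_ PD _] := Ps; apply: (PD); first exact: ideal_mulr.
rewrite mulrDr; apply: PD; first exact: ideal_mull.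
by rewrite mulrACA; apply: ideal_mull.
Qed.

(** The last hypothesis says that [q] is nilpotent modulo [I] after localization at [q], so [q] is
    minimal over [I] and hence associated to A / I. The witness [y] makes the colon ideal (I : y)
    maximal among those contained in [q]. *)
Lemma associated_prime_over (I q : A^o -> Prop) : noetherian A ->
  is_sub I -> is_prime q -> (forall a, I a -> q a) ->
  (forall b : A, q b -> exists (n : nat) (s : A), ~ q s /\ I (s * b ^+ n)) ->
  exists y : A, forall a : A, q a <-> I (a * y).
Proof.
move=> nA Is qp Iq nil; have [I0 ID IZ] := Is.
pose colon y (a : A^o) := I ((a : A) * y).
have colon_sub y : is_sub (colon y).
  split=> [|a b Ia Ib|a b Ib]; rewrite /colon ?mul0r ?mulrDl //; first exact: ID.
  by rewrite /GRing.scale /= -mulrA; apply: ideal_mull.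
pose F J := exists2 y, J = colon y & forall a, J a -> q a.
have [||_ [y -> yq] ymax] := noetherian_max (F := F) (K0 := colon 1) nA
  regular_fin_gen.
- by move=> _ [y -> _].
- by exists 1 => // a; rewrite /colon mulr1; apply: Iq.
have absorb y' : (forall a, colon y a -> colon y' a) ->
    (forall a, colon y' a -> q a) -> forall a, colon y' a -> colon y a.
  by move=> yy' y'q; apply: ymax => //; exists y'.
exists y => a; split=> [qa|/yq//].
have [n [s [qs Isa]]] := nil a qa.
(* The last power of [a] by which [y] can be multiplied with the colon ideal still inside [q];
   nilpotency of [a] bounds it. *)
have [m ymq nyq] : exists2 m, (forall b, colon (y * a ^+ m) b -> q b) &
    ~ forall b, colon (y * a ^+ m.+1) b -> q b.
  apply: contrapT => nm.
  suff /(_ n) aq : forall m b, colon (y * a ^+ m) b -> q b.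
    by apply: qs; apply: (aq s); rewrite /colon mulrCA; apply: ideal_mull.
  elim=> [|m IHm]; first by rewrite expr0 mulr1.
  by apply: contrapT => h; apply: nm; exists m.
have [b [Iyb nqb]] : exists b, colon (y * a ^+ m.+1) b /\ ~ q b.
  apply: contrapT => nb; apply: nyq => b Ib.
  by apply: contrapT => nqb; apply: nb; exists b.
(* By maximality the factor [a ^+ m] does not enlarge the colon ideal of [y]. *)
have Iba : colon y (b * a).
  apply: (absorb (y * a ^+ m)) => //.
    by move=> c; rewrite /colon mulrA; apply: ideal_mulr.
  by rewrite /colon (_ : _ * _ = (b : A) * (y * a ^+ m.+1)) // exprS; ring.
(* As [b] lies outside the prime [q], the colon ideal of [y * b] stays in [q], so it equals that of
   [y]; it contains [a]. *)
apply: (absorb (y * b)) => [c|c|].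
- by rewrite /colon mulrA; apply: ideal_mulr.
- rewrite /colon (_ : _ * _ = ((c : A) * b) * y); last by ring.
  by move=> /yq; case: qp => _ _ qM /qM[].
- by rewrite /colon (_ : _ * _ = (b : A) * a * y) //; ring.
Qed.

End Submodules.

(** * From predicates to bundled ideals *)

Section PrimeIdealr.
Variables (A : comNzRingType) (P : A^o -> Prop).

Section Ideal.
Variables (Ps : is_sub P) (P1 : ~ P 1).

Definition ideal_pred : A -> bool := let _ := (Ps, P1) in fun a => `[< P a >].

Fact ideal_pred_closed : idealr_closed ideal_pred.
Proof.
have [P0 PD PZ] := Ps; split; first exact/asboolP; first exact/asboolP.
by move=> a u v /asboolP Pu /asboolP Pv; apply/asboolP/PD => //; apply: PZ.
Qed.

HB.instance Definition _ := isIdealr.Build A ideal_pred ideal_pred_closed.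

Lemma idealrP : exists p : idealr A, forall a, a \in p <-> P a.
Proof.
exists (Idealr.clone A ideal_pred _) => a.
by split=> [/asboolP|Pa] //; apply/asboolP.
Qed.

End Ideal.

Section Prime.
Variable (Pp : is_prime P).

Definition prime_pred : A -> bool := let _ := Pp in fun a => `[< P a >].

Fact prime_pred_closed : idealr_closed prime_pred.
Proof. by case: Pp => Ps P1 _; apply: (ideal_pred_closed Ps P1). Qed.

Fact prime_pred_prime : prime_idealr_closed prime_pred.
Proof.
case: Pp => _ _ PM a b /asboolP/PM[Pa|Pb]; apply/orP; [left|right];
  exact/asboolP.
Qed.

HB.instance Definition _ := isIdealr.Build A prime_pred prime_pred_closed.
HB.instance Definition _ :=
  isPrimeIdealrClosed.Build A prime_pred prime_pred_prime.

Lemma prime_idealrP : exists p : prime_idealr A, forall a, a \in p <-> P a.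
Proof.
exists (PrimeIdealr.clone A prime_pred _) => a.
by split=> [/asboolP|Pa] //; apply/asboolP.
Qed.

End Prime.
End PrimeIdealr.

Lemma idealr_sub (A : comNzRingType) (p : idealr A) :
  is_sub (fun a : A^o => a \in (p : idealr A)).
Proof.
split=> [|a b pa pb|a b pb]; first exact: idealr0; first exact: rpredD.
exact: idealMr.
Qed.

Lemma prime_idealr_prime (A : comNzRingType) (p : prime_idealr A) :
  is_prime (fun a : A^o => a \in (p : prime_idealr A)).
Proof.
split; [exact: (idealr_sub p)|by rewrite idealr1|].
by move=> a b; rewrite prime_idealrM => /orP.
Qed.

(** * Quotient modules *)

Section QuotientModule.
Local Open Scope quotient_scope.
Variables (A : comNzRingType) (M : lmodType A) (K : M -> Prop) (Ks : is_sub K).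

Definition zmod_pred : M -> bool := let _ := Ks in fun m => `[< K m >].

Fact zmod_pred_closed : zmod_closed zmod_pred.
Proof.
split; first by apply/asboolP; case: Ks.
by move=> m n /asboolP Km /asboolP Kn; apply/asboolP; apply: subB.
Qed.

HB.instance Definition _ := GRing.isZmodClosed.Build M zmod_pred zmod_pred_closed.

Definition zmod_sub : zmodClosed M := GRing.ZmodClosed.clone M zmod_pred _.

Definition quotm : Type := Quotient.quot zmod_sub.

HB.instance Definition _ := GRing.Zmodule.on quotm.

Definition to_quotm (m : M) : quotm := \pi_(Quotient.quot zmod_sub) m.

Lemma eq_quotm m n : to_quotm m = to_quotm n <-> K (m - n).
Proof.
rewrite /to_quotm; split=> [/eqP|Kmn].
  by rewrite -Quotient.idealrBE => /asboolP.
by apply/eqP; rewrite -Quotient.idealrBE; apply/asboolP.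
Qed.

Lemma to_quotm_surj y : exists m, y = to_quotm m.
Proof. by exists (repr (y : Quotient.quot zmod_sub));
  rewrite /to_quotm reprK. Qed.

Lemma to_quotmD m n : to_quotm (m + n) = to_quotm m + to_quotm n.
Proof. exact: (raddfD (\pi_(Quotient.quot zmod_sub))). Qed.

Definition quotm_scale (a : A) (y : quotm) : quotm :=
  to_quotm (a *: repr (y : Quotient.quot zmod_sub)).

Lemma quotm_scaleE a m : quotm_scale a (to_quotm m) = to_quotm (a *: m).
Proof.
apply/eq_quotm; rewrite -scalerBr; case: (Ks) => _ _; apply.
by apply/eq_quotm; rewrite /to_quotm reprK.
Qed.

Fact quotm_scaleA a b y :
  quotm_scale a (quotm_scale b y) = quotm_scale (a * b) y.
Proof. by have [m ->] := to_quotm_surj y; rewrite !quotm_scaleE scalerA. Qed.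
Fact quotm_scale1 : left_id 1 quotm_scale.
Proof. by move=> y; have [m ->] := to_quotm_surj y;
  rewrite quotm_scaleE scale1r. Qed.
Fact quotm_scaleDr : right_distributive quotm_scale +%R.
Proof.
move=> a y z; have [m ->] := to_quotm_surj y; have [n ->] := to_quotm_surj z.
by rewrite -to_quotmD !quotm_scaleE scalerDr to_quotmD.
Qed.
Fact quotm_scaleDl y : {morph quotm_scale^~ y : a b / a + b}.
Proof.
move=> a b; have [m ->] := to_quotm_surj y.
by rewrite !quotm_scaleE scalerDl to_quotmD.
Qed.

HB.instance Definition _ := GRing.Zmodule_isLmodule.Build A quotm
  quotm_scaleA quotm_scale1 quotm_scaleDr quotm_scaleDl.

Fact to_quotm_linear : linear to_quotm.
Proof. by move=> a m n; rewrite to_quotmD -quotm_scaleE. Qed.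

HB.instance Definition _ :=
  GRing.isLinear.Build A M quotm *:%R to_quotm to_quotm_linear.

Lemma quotient_module : exists (L : lmodType A) (g : {linear M -> L}),
  (forall y, exists m, y = g m) /\ forall m, g m = 0 <-> K m.
Proof.
exists quotm, to_quotm; split; first exact: to_quotm_surj.
move=> m; rewrite -{2}[m]subr0 -eq_quotm.
by rewrite [to_quotm 0]raddf0.
Qed.

End QuotientModule.

(** * Finite injective dimension over an Artinian local ring *)

(** Together with [is_sub G], this makes [G] the graph of a linear map defined on a submodule of
    [N], so partial maps need no subtype for their domain. *)
Definition functional (A : comNzRingType) (N M : lmodType A)
  (G : N * M -> Prop) := forall m, G (0, m) -> m = 0.

Lemma graph_ext (A : comNzRingType) (N M : lmodType A) (G : N * M -> Prop) a m n :
  is_sub G -> functional G -> G (a, m) -> G (a, n) -> m = n.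
Proof.
move=> Gs Gf Gm Gn; apply/subr0_eq/Gf.
by have := subB Gs Gm Gn; rewrite /GRing.add /= /add_pair /= subrr.
Qed.

(** Baer's criterion: a linear map from an ideal to [M] extends to [A], and [x] is the image of
    1. *)
Definition baer (A : comNzRingType) (M : lmodType A) :=
  forall G : A^o * M -> Prop, is_sub G -> functional G ->
    exists x, forall a m, G (a, m) -> m = a *: x.

Lemma injective_baer (A : comNzRingType) (M : lmodType A) :
  injective_module M -> baer M.
Proof.
move=> Minj G Gs Gf; pose I := to_submod Gs.
pose f : {linear submod I -> A^o} := @fst A^o M \o val.
pose h : {linear submod I -> M} := @snd A^o M \o val.
have f_inj : injective f.
  move=> u v uv; apply: val_inj.
  have /to_submodP := valP u; have /to_submodP := valP v; move: uv.
  rewrite /f /=; case: (val u) (val v) => [a m] [b n] /= -> Gv Gu.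
  by rewrite (graph_ext Gs Gf Gu Gv).
have [h' h'f] := Minj _ _ f h f_inj.
exists (h' 1) => a m Gam.
have GI : (a, m) \in I by apply/to_submodP.
have := h'f (Submod GI); rewrite /f /h /= => <-.
by rewrite -linearZ /= /GRing.scale /= mulr1.
Qed.

Section FiniteInjectiveDimension.
Variables (A : comNzRingType) (z : A).
Hypotheses (nA : noetherian A) (z0 : z <> 0).
Hypothesis unitVsocle : forall a : A, a * z = 0 \/ exists b, a * b = 1.
Hypothesis socle_nil : forall a : A, a * z = 0 -> exists n, a ^+ n = 0.

(* The residue field embeds in A as Az, so maps from it to C extend to A by
   injectivity and then lift to E by freeness: Ext^1(A/m, X) = 0.  *)
Lemma baer_kernel (X E C : lmodType A) (f : {linear X -> E})
    (g : {linear E -> C}) :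
  injective_module E -> short_exact f g -> baer C -> baer X.
Proof.
move=> /injective_baer Einj [f_inj fg g_surj] Cinj.
have lift c : (forall a, a * z = 0 -> a *: c = 0) ->
    exists2 e, g e = c & forall a, a * z = 0 -> a *: e = 0.
  move=> zc.
  have [|_ [a [/esym az ->]]|x xP] := Cinj (fun p => exists a, p = (a * z,
    a *: c)).
  - split=> [|_ _ [a ->] [b ->]|b _ [a ->]].
    + by exists 0; rewrite mul0r scale0r.
    + by exists (a + b); rewrite mulrDl scalerDl.
    + by exists (b * a); rewrite -mulrA -scalerA.
  - exact: zc.
  have [e xe] := g_surj x; exists (z *: e).
    rewrite linearZ /= -xe -(xP z c) //.
    by exists 1; rewrite mul1r scale1r.
  by move=> a az; rewrite scalerA az scale0r.
(* An extension [G'] with maximal domain [D] is shown to be defined at 1. Otherwise [D] lies in the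
   ideal [q] of non-units, and some [y] has (D : y) = q; the map is then extended to [y]. *)
move=> G Gs Gf; pose ext G' := [/\ is_sub G', functional G'
  & forall p : A^o * X, G p -> G' p].
pose F D := exists2 G', ext G' & D = fun a => exists m, G' (a, m).
have [||D [G' [G's G'f GG'] DE] Dmax] := noetherian_max (F := F)
  (K0 := fun a => exists m, G (a, m)) nA (regular_fin_gen A); last 1 first.
- have [G'0 G'D G'Z] := G's.
  have Ds : is_sub D.
    rewrite DE; split=> [|a b [m am] [n bn]|b a [m am]]; first by exists 0.
      by exists (m + n); apply: G'D am bn.
    by exists (b *: m); apply: G'Z am.
  have [D1|D1] := pselect (D 1).
    move: D1; rewrite DE => -[x G'x]; exists x => a m /GG' G'am.
    apply: graph_ext G's G'f G'am _; have := G'Z a _ G'x.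
    by rewrite /GRing.scale /= /scale_pair /= /GRing.scale /= mulr1.
  pose q (a : A^o) := (a : A) * z = 0.
  have Dq a : D a -> q a.
    move=> Da; have [//|[b ab]] := unitVsocle a; case: D1.
    by rewrite -ab; apply: ideal_mulr.
  have qp : is_prime q.
    split=> [||a b qab].
    - split=> [|a b qa qb|b a qa]; rewrite /q ?mul0r ?mulrDl ?qa ?qb ?addr0 //.
      by rewrite /GRing.scale /= -mulrA qa mulr0.
    - by rewrite /q mul1r.
    - have [|[a' aa']] := unitVsocle a; first by left.
      right; rewrite /q -[(b : A)]mul1r -aa' [a * a']mulrC -!mulrA.
      rewrite [a * (b * z)]mulrA.
      by rewrite qab mulr0.
  have [b qb|y yq] := associated_prime_over nA Ds qp Dq.
    have [n bn] := socle_nil qb; exists n, 1; rewrite bn mulr0.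
    by case: qp Ds => _ q1 _ [].
  (* [x] is the value to be given to [y]. Injectivity of [E] supplies a candidate [e] in [E]; its
     image in [C] is killed by [q], so it lifts to some [e0] killed by [q], and [e - e0] comes from
     [X] with the same multiples by [q]. *)
  have [x xP] : exists x, forall b m, q b -> G' (b * y, m) -> m = b *: x.
    have [||e eP] := Einj (fun p =>
      exists m, [/\ q p.1, G' ((p.1 : A) * y, m) & p.2 = f m]).
    - case: (qp) => [[q0 qD qZ] _ _].
      split=> [|a b [m [qa Gm am]] [n [qb Gn bn]]|b a [m [qa Gm am]]] /=.
      + by exists 0; split; rewrite ?mul0r ?linear0.
      + exists (m + n); split; rewrite ?linearD -?am -?bn //; first exact: qD.
        by rewrite mulrDl; apply: G'D Gm Gn.
      + exists (b *: m); split; rewrite ?linearZ -?am //; first exact: qZ.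
        by rewrite /GRing.scale /= -mulrA; apply: G'Z Gm.
    - by move=> e [m /= [_]]; rewrite mul0r => /G'f -> ->; rewrite linear0.
    have fb b m : q b -> G' (b * y, m) -> f m = b *: e.
      by move=> qb Gm; apply: eP; exists m.
    have [b bz|e0 e0c e0z] := lift (g e).
      have : D ((b : A) * y) by apply/yq.
      rewrite DE => -[m Gm]; rewrite -linearZ -(fb b m) //=.
      by apply/fg; exists m.
    have [|x xe] := (fg (e - e0)).1; first by rewrite linearB /= e0c subrr.
    exists x => b m qb Gm; apply: f_inj.
    by rewrite linearZ /= -xe (fb b) // scalerBr (e0z b qb) subr0.
  exfalso; pose G2 := adjoin G' (y : A^o, x).
  have G2s : is_sub G2 by apply: adjoin_sub.
  have G2y : D y.
    apply: (Dmax (fun a => exists m, G2 (a, m))).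
    - exists G2 => //; split=> // [m [r G'r]|p /GG'] ; last exact: adjoin_incl.
      have Gry : G' (r *: (y : A^o), r *: x - m).
        rewrite (_ : (_, _) = - ((0, m) - r *: (y : A^o, x))); first exact: subN.
        by apply: injective_projections; rewrite /= opprB ?subr0.
      have qr : q r by apply/yq; rewrite DE; eexists; apply: Gry.
      apply/eqP; rewrite -oppr_eq0 -(addKr (r *: x) (- m)) (xP r _ qr Gry).
      by rewrite addrC subrr.
    - by rewrite DE => a [m am]; exists m; apply: adjoin_incl.
    - by exists x; apply: adjoin_gen.
  by case: qp => _ q1 _; apply: q1; apply/yq; rewrite mul1r.
- by move=> _ [G' [[G0 GD GZ] _ _] ->]; split=> [|a b [m am] [n bn]|b a [m am]];
  [exists 0|exists (m + n); apply: GD am bn|exists (b *: m); apply: GZ am].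
- by exists G.
Qed.

Lemma injdim_baer n (M : lmodType A) : injdim_le n M -> baer M.
Proof.
elim: n M => [|n IHn] M; first exact: injective_baer.
by move=> [E [C [f [g [Einj fg /IHn]]]]]; apply: baer_kernel fg.
Qed.

End FiniteInjectiveDimension.

(** * Localizations *)

Section Localization.
Variables (A : comNzRingType) (W : mulSet A).

Lemma rfracP (x : loc_ring W) : exists a s, x = rfrac a s.
Proof. exact: (@fracP A W A^o x). Qed.

Lemma rfrac_eq (a b : A) (s t : denom W) : rfrac a s = rfrac b t <->
  exists2 u, u \in W & u * (sval t * a) = u * (sval s * b).
Proof. exact: (@eq_frac A W A^o). Qed.

Lemma rfracM (a b : A) (s t : denom W) :
  rfrac a s * rfrac b t = rfrac (a * b) (denomM s t).
Proof. exact: loc_mulE. Qed.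

Lemma rfracD (a b : A) (s t : denom W) :
  rfrac a s + rfrac b t = rfrac (sval t * a + sval s * b) (denomM s t).
Proof. exact: (@locDE A W A^o). Qed.

Lemma rfrac_eq0 (a : A) (s : denom W) :
  rfrac a s = 0 <-> exists2 u, u \in W & u * a = 0.
Proof.
rewrite (rfrac_eq a 0 s (denom1 W)) /=.
by split=> -[u uW]; rewrite ?mul1r ?mulr0 => e; exists u; rewrite ?mul1r ?mulr0.
Qed.

Lemma rfrac_eq1 (a : A) (s : denom W) :
  rfrac a s = 1 <-> exists2 u, u \in W & u * a = u * sval s.
Proof.
rewrite (rfrac_eq a 1 s (denom1 W)) /=.
by split=> -[u uW]; rewrite ?mul1r ?mulr1 => e; exists u; rewrite ?mul1r ?mulr1.
Qed.

Lemma rfracX (a : A) (s : denom W) n :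
  exists t, rfrac a s ^+ n = rfrac (a ^+ n) t.
Proof.
elim: n => [|n [t IHn]]; first by exists (denom1 W).
by exists (denomM s t); rewrite exprS IHn rfracM -exprS.
Qed.

Lemma loc_frac_eq0 (M : lmodType A) (m : M) (s : denom W) :
  (Defs.frac m s : loc W M) = 0 <-> exists2 u, u \in W & u *: m = 0.
Proof.
rewrite (eq_frac m s 0 (denom1 W)) /=.
by split=> -[u uW]; rewrite ?scale1r ?scaler0 => e; exists u;
  rewrite ?scale1r ?scaler0.
Qed.

Lemma loc_scaleM (M : lmodType A) (a : A) (m : M) (s t : denom W) :
  rfrac a s *: (Defs.frac m t : loc W M) = Defs.frac (a *: m) (denomM s t).
Proof. exact: loc_scaleE. Qed.

End Localization.

Section GorensteinPrime.
Variables (R : comNzRingType) (q : prime_idealr R).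
Hypotheses (nR : noetherian R) (q_ass : associated_prime q)
  (q_gor : gorenstein_local_ring (ring_at q))
  (q_nil : forall b, b \in q -> exists n s, s \notin q /\ s * b ^+ n = 0).

(** The element of [R] with annihilator [q] becomes the required socle element of the
    localization. *)
Lemma ring_at_baer : @baer (ring_at q) (ring_at q)^o.
Proof.
have [nA _ [n idA]] := q_gor; have [y yP] := q_ass.
apply: (injdim_baer (z := to_loc (prime_mulset q) y)) idA => //.
- move=> /rfrac_eq0[u uq uy]; move: uq; rewrite unfold_in => /negP; apply.
  exact/yP.
- move=> x; have [a [s ->]] := rfracP x.
  have [aq|aq] := boolP (a \in q).
    left; rewrite /to_loc rfracM; apply/rfrac_eq0; exists 1; first exact: rpred1.
    by rewrite mul1r; apply/yP.
  right; pose a' : denom (prime_mulset q) := exist _ a aq.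
  exists (rfrac (sval s) a'); rewrite rfracM; apply/rfrac_eq1.
  by exists 1; [exact: rpred1|rewrite /= [a * _]mulrC].
- move=> x; have [a [s ->]] := rfracP x; rewrite /to_loc rfracM.
  move=> /rfrac_eq0[u uq uay].
  have aq : a \in q.
    have : u * a \in q by apply/yP; rewrite -mulrA.
    by rewrite prime_idealrM; move: uq; rewrite unfold_in => /negPf->.
  have [k [t [tq ta]]] := q_nil aq; exists k.
  have [s' ->] := rfracX a s k; apply/rfrac_eq0; by exists t.
Qed.

(** The localized map is multiplication by a fraction. Each pair in [G] verifies this only after
    multiplication by an element outside [q]; since the domain of [G] is finitely generated, one
    such element serves all pairs. *)
Lemma local_extension (G : R^o * R^o -> Prop) : is_sub G -> functional G ->
  exists s r0, s \notin q /\ forall a r : R, G (a, r) -> s * r = a * r0.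
Proof.
move=> Gs Gf; have [G0 GD GZ] := Gs.
pose GA (p : (ring_at q)^o * (ring_at q)^o) :=
  exists (a r : R) (s : denom (prime_mulset q)),
    G (a, r) /\ p = (rfrac a s : (ring_at q)^o, rfrac r s : (ring_at q)^o).
have [||x xP] := ring_at_baer (G := GA).
- split=> [|_ _ [a [r [s [Ga ->]]]] [b [t [u [Gb ->]]]]|x _ [a [r [s [Ga ->]]]]].
  + by exists 0, 0, (denom1 (prime_mulset q)).
  + exists (sval u * a + sval s * b), (sval u * r + sval s * t), (denomM s u).
    split; first exact: GD (GZ _ _ Ga) (GZ _ _ Gb).
    by rewrite -!rfracD.
  + have [b [t ->]] := rfracP x; exists (b * a), (b * r), (denomM t s).
    split; first exact: GZ Ga.
    by rewrite -!rfracM.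
- move=> _ [a [r [s [Ga [/esym/rfrac_eq0[u uq ua] ->]]]]].
  apply/rfrac_eq0; exists u => //; apply: Gf.
  by rewrite -[0 : R]ua; apply: GZ Ga.
have [r0 [s0 x0]] := rfracP x.
have eqG (a r : R) : G (a, r) -> exists2 u,
  u \notin q & u * (sval s0 * r - a * r0) = 0.
  move=> Ga; have : rfrac r (denom1 (prime_mulset q)) =
    rfrac a (denom1 (prime_mulset q)) * x :> ring_at q.
    by apply: xP; exists a, r, (denom1 (prime_mulset q)).
  rewrite x0 rfracM => /rfrac_eq[u uq]; rewrite /= !mul1r => e.
  by exists u; rewrite // mulrBr e subrr.
pose D (a : R^o) := exists r, G (a, r).
have Ds : is_sub D.
  split=> [|a b [r Ga] [t Gb]|b a [r Ga]]; first by exists 0.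
    by exists (r + t); apply: GD Ga Gb.
  by exists (b *: r); apply: GZ Ga.
have [l [lD Dspan]] := noetherian_fg nR Ds.
have [t tq tl] : exists2 t, t \notin q &
    forall a, a \in l -> exists2 r, G (a, r) & t * (sval s0 * r - a * r0) = 0.
  elim: l lD {Dspan} => [|a l IHl] lD.
    by exists 1 => //; rewrite idealr1.
  have [b bl|t tq tl] := IHl; first by apply: lD; rewrite inE bl orbT.
  have [r Ga] := lD a (mem_head _ _); have [u uq ur] := eqG a r Ga.
  exists (t * u); first by rewrite prime_idealrM negb_or tq.
  move=> b; rewrite inE => /predU1P[->|/tl[r' Gb tr']].
    by exists r; rewrite // -mulrA ur mulr0.
  by exists r'; rewrite // [t * u]mulrC -mulrA tr' mulr0.
exists (t * sval s0), (t * r0); split.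
  by rewrite prime_idealrM negb_or tq; exact: svalP s0.
move=> a r Ga.
have Da : D a by exists r.
have [||r' [Ga' er']] := Dspan a Da
  (fun a => exists r, G (a, r) /\ t * (sval s0 * r - (a : R) * r0) = 0).
- split=> [|b c [rb [Gb eb]] [rc [Gc ec]]|c b [rb [Gb eb]]].
  + by exists 0; rewrite !mul0r mulr0 subrr mulr0.
  + exists (rb + rc); split; first exact: GD Gb Gc.
    have e (b' c' rb' rc' : R) : t * (sval s0 * (rb' + rc') - (b' + c') * r0)
      = t * (sval s0 * rb' - b' * r0) + t * (sval s0 * rc' - c' * r0) by ring.
    by rewrite [LHS]e eb ec addr0.
  + exists (c *: rb); split; first exact: GZ Gb.
    have e (b' rb' : R) : t * (sval s0 * (c * rb') - (c * b') * r0)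
      = c * (t * (sval s0 * rb' - b' * r0)) by ring.
    by rewrite [LHS]e eb mulr0.
- by move=> b /tl[rb Gb eb]; exists rb.
rewrite (graph_ext Gs Gf Ga Ga').
by apply/eqP; rewrite -subr_eq0 -er'; apply/eqP; ring.
Qed.

End GorensteinPrime.

(** * Generically Gorenstein rings of dimension one *)

Lemma inj_surj_bijective (T U : Type) (f : T -> U) :
  injective f -> (forall u, exists t, u = f t) -> bijective f.
Proof.
by move=> f_inj /choice[g gP]; exists g => [t|u]; [apply: f_inj|]; rewrite -gP.
Qed.

Section Modules.
Variables (A : comNzRingType).
Implicit Types M N P : lmodType A.

Lemma fin_gen_inj N P (f : {linear N -> P}) :
  noetherian A -> injective f -> fin_gen P -> fin_gen N.
Proof.
move=> nA f_inj Pfg; apply/fin_genP; pose K p := exists n, p = f n.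
have Ks : is_sub K.
  split=> [|_ _ [m ->] [n ->]|a _ [m ->]]; first by exists 0; rewrite linear0.
    by exists (m + n); rewrite linearD.
  by exists (a *: m); rewrite linearZ.
have [s [sK Kspan]] := sub_fg nA Pfg Ks.
have /choice[g gP] : forall p, exists n, K p -> p = f n.
  move=> p; have [[n ->]|nK] := pselect (K p); first by exists n.
  by exists 0 => /nK.
exists (map g s) => n L Ls sL.
have [||n' [/f_inj -> //]] := Kspan (f n) (ex_intro _ n erefl)
  (fun p => exists n, p = f n /\ L n).
  have [L0 LD LZ] := Ls.
  split=> [|_ _ [m [-> Lm]] [m' [-> Lm']]|a _ [m [-> Lm]]].
  - by exists 0; rewrite linear0.
  - by exists (m + m'); rewrite linearD; split=> //; apply: LD.
  - by exists (a *: m); rewrite linearZ; split=> //; apply: LZ.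
by move=> p ps; exists (g p); split; [apply/gP/sK|apply/sL/map_f].
Qed.

Lemma fin_gen_surj P N (g : {linear P -> N}) :
  (forall n, exists p, n = g p) -> fin_gen P -> fin_gen N.
Proof.
move=> g_surj [k [e eP]]; exists k, (g \o e) => n.
have [p ->] := g_surj n; have [c ->] := eP p; exists c.
by rewrite linear_sum; apply: eq_bigr => i _; rewrite linearZ.
Qed.

Lemma linearP_ex P N (f : P -> N) : linear f -> exists g : {linear P ->
  N}, g =1 f.
Proof.
move=> f_lin; pose F := GRing.isLinear.Build A P N *:%R f f_lin.
by unshelve eexists (HB.pack_for {linear P -> N} f F).
Qed.

Lemma functional_linear P N (G : P * N -> Prop) : is_sub G -> functional G ->
  (forall p, exists n, G (p, n)) ->
  exists g : {linear P -> N}, forall p n, G (p, n) <-> n = g p.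
Proof.
move=> Gs Gf /choice[f fP].
have fE p n : G (p, n) <-> n = f p.
  by split=> [Gn|-> //]; apply: graph_ext Gs Gf Gn _.
have [a p p'|g gf] := @linearP_ex P N f.
  apply/esym/fE; have [_ GD GZ] := Gs.
  exact: GD (GZ a _ (fP p)) (fP p').
by exists g => p n; rewrite gf.
Qed.

End Modules.

Section OneDimensional.
Variables (R : comNzRingType) (m : R^o -> Prop) (x : R).
Hypotheses (nR : noetherian R) (mp : is_prime m)
  (mU : forall a : R, m a \/ exists b, a * b = 1) (mx : m x)
  (x_reg : forall a, x * a = 0 -> a = 0).
Hypothesis height1 : forall p q : R^o -> Prop, is_prime p -> is_prime q ->
  (forall a, p a -> q a) -> ~ (forall a, q a -> p a) -> forall a, m a -> q a.

Lemma xpow_reg n a : x ^+ n * a = 0 -> a = 0.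
Proof.
by elim: n a => [|n IHn] a; rewrite ?mul1r // exprSr -mulrA => /IHn/x_reg.
Qed.

Lemma prime_sub_max (q : R^o -> Prop) a : is_prime q -> q a -> m a.
Proof.
move=> [qs q1 _] qa; have [//|[b ab]] := mU a; case: q1.
by rewrite -ab; apply: ideal_mulr.
Qed.

Lemma zero_sub (A : comNzRingType) (M : lmodType A) : is_sub (fun n : M => n = 0).
Proof. by split=> // [a b -> ->|a b ->]; rewrite ?addr0 ?scaler0. Qed.

Lemma smaller_prime (q : R^o -> Prop) (b : R) : is_prime q ->
  (forall (n : nat) (s : R), ~ q s -> s * b ^+ n <> 0) ->
  exists q', [/\ is_prime q', forall a, q' a -> q a & ~ q' b].
Proof.
move=> qp qb; pose W (a : R^o) := exists n s, ~ q s /\ a = s * b ^+ n.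
have [||||q' [q'p _ q'W]] := @prime_avoidance _ (fun a : R^o => a = 0) W nR.
- exact: zero_sub.
- by exists 0%N, 1; rewrite mulr1; case: qp.
- move=> _ _ [n [s [qs ->]]] [k [t [qt ->]]]; exists (n + k)%N, (s * t).
  by split; [apply: prime_mul_closed|rewrite exprD; ring].
- by move=> _ -> [n [s [qs e]]]; apply: (qb n s).
exists q'; split=> // [a q'a|q'b].
  apply: contrapT => nqa; apply: (q'W a q'a); exists 0%N, a.
  by rewrite mulr1.
apply: (q'W b q'b); exists 1%N, 1; rewrite mul1r expr1.
by case: qp.
Qed.

Lemma regular_prime (q : R^o -> Prop) (b : R) : is_prime q -> q b ->
  (forall a, b * a = 0 -> a = 0) -> forall a, m a -> q a.
Proof.
move=> qp qb b_reg.
have [n s qs sb|p [pp pq pb]] := @smaller_prime q b qp.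
  apply: qs; suff -> : s = 0 by case: qp => -[].
  elim: n sb => [|n IHn]; first by rewrite mulr1.
  by rewrite exprS mulrCA => /b_reg.
by apply: (height1 pp qp pq) => qp'; apply/pb/qp'.
Qed.

Lemma power_closed (A : comNzRingType) (c : A) :
  let W (a : A^o) := exists n : nat, a = c ^+ n in
  W 1 /\ forall a b : A, W a -> W b -> W (a * b).
Proof.
split; first by exists 0%N.
by move=> _ _ [n ->] [k ->]; exists (n + k)%N; rewrite exprD.
Qed.

Lemma principal_sub (A : comNzRingType) (c : A) :
  is_sub (fun a : A^o => exists d : A, a = c * d).
Proof.
split=> [|_ _ [d ->] [e ->]|a _ [d ->]]; first by exists 0; rewrite mulr0.
  by exists (d + e); rewrite mulrDr.
by exists (a * d); rewrite /GRing.scale /= mulrCA.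
Qed.

Lemma max_nil_mod_x b : m b -> exists (n : nat) (c : R), b ^+ n = x * c.
Proof.
move=> mb; apply: contrapT => nb; have [W1 WM] := power_closed b.
have [_ [c ->] [n bn]|q [qp xq qb]] :=
  prime_avoidance nR (principal_sub x) W1 WM.
  by apply: nb; exists n, c.
apply: (qb b); last by exists 1%N.
apply: (regular_prime (b := x)) => //; apply: xq.
by exists 1; rewrite mulr1.
Qed.

(** A prime containing [t] contains [m], hence [x]. So inverting [x] alone already produces the
    total ring of fractions. *)
Lemma regular_dvd_xpow t : (forall a, t * a = 0 -> a = 0) ->
  exists (n : nat) (c : R), x ^+ n = t * c.
Proof.
move=> t_reg; apply: contrapT => nt; have [W1 WM] := power_closed x.
have [_ [c ->] [n tn]|q [qp tq qx]] :=
  prime_avoidance nR (principal_sub t) W1 WM.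
  by apply: nt; exists n, c.
apply: (qx x); last by exists 1%N.
by apply: (regular_prime (b := t)) => //; apply: tq; exists 1; rewrite mulr1.
Qed.

Lemma minimal_prime_nil (q : R^o -> Prop) (b : R) : is_prime q -> ~ q x ->
  q b -> exists (n : nat) (s : R), ~ q s /\ s * b ^+ n = 0.
Proof.
move=> qp qx qb; apply: contrapT => nb.
have [n s qs sb|p [pp pq pb]] := @smaller_prime q b qp.
  by apply: nb; exists n, s.
apply: qx; apply: (height1 pp qp pq) => // qp'; exact/pb/qp'.
Qed.

(** Primes that miss [x] are minimal, hence associated: there the Gorenstein hypothesis applies. *)
Lemma minimal_prime_ass (q : R^o -> Prop) : is_prime q -> ~ q x ->
  exists y : R, forall a : R, q a <-> a * y = 0.
Proof.
move=> qp qx.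
have [a ->|b qb|y yP] := associated_prime_over nR (zero_sub R^o) qp.
- by case: qp => -[].
- exact: minimal_prime_nil.
- by exists y.
Qed.

(** Testing [x] alone suffices, as every non-zero-divisor divides a power of it. *)
Definition torsion_free (M : lmodType R) := forall n : M, x *: n = 0 -> n = 0.

Lemma torsion_freeX (M : lmodType R) k (n : M) :
  torsion_free M -> x ^+ k *: n = 0 -> n = 0.
Proof.
move=> tfM; elim: k n => [|k IHk] n; first by rewrite scale1r.
by rewrite exprSr -scalerA => /IHk/tfM.
Qed.

Hypothesis R_gG : generically_gorenstein R.

Lemma minimal_extension (q : R^o -> Prop) (G : R^o * R^o -> Prop) :
  is_prime q -> ~ q x -> is_sub G -> functional G ->
  exists s r0, ~ q s /\ forall a r : R, G (a, r) -> s * r = a * r0.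
Proof.
move=> qp qx Gs Gf; have [p pq] := prime_idealrP qp.
have [y yP] := minimal_prime_ass qp qx.
have p_ass : associated_prime p by exists y => a; rewrite pq.
have [b /pq qb|s [r0 [ps sP]]] := local_extension nR p_ass (R_gG p_ass) _ Gs Gf.
  have [n [s [qs sb]]] := minimal_prime_nil qp qx qb.
  by exists n, s; split=> //; apply/negP => /pq.
by exists s, r0; split=> // /pq; apply/negP.
Qed.

(* Self-injectivity of the total ring of fractions, with denominators cleared. *)
Lemma functional_extension (P : lmodType R) (G : P * R^o -> Prop) :
  fin_gen P -> is_sub G -> functional G ->
  exists n (g : {linear P -> R^o}), forall p (r : R), G (p, r) ->
    g p = x ^+ n * r.
Proof.
move=> /fin_genP[l lP] Gs Gf; apply: contrapT => nG.
(* The ideal of denominators [d] for which [d] times the partial functional extends to [P]; it must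
   contain a power of [x]. *)
pose D (d : R^o) := exists g : {linear P -> R^o},
  forall p (r : R), G (p, r) -> g p = d * r.
have Ds : is_sub D.
  split=> [|a b [g gP] [h hP]|a b [g gP]].
  - by exists \0 => p r _; rewrite mul0r.
  - by exists (g \+ h) => p r Gp /=; rewrite (gP _ _ Gp) (hP _ _ Gp) mulrDl.
  - by exists (a \*: g) => p r Gp /=; rewrite (gP _ _ Gp) /GRing.scale /= mulrA.
have [W1 WM] := power_closed x.
have [a [g gP] [n xn]|q [qp Dq qW]] := prime_avoidance nR Ds W1 WM.
  by apply: nG; exists n, g; rewrite -xn.
have qx : ~ q x by move=> /qW; apply; exists 1%N.
suff [s [G' [qs G's G'f GG' G'l]]] : exists (s : R) (G' : P * R^o -> Prop),
    [/\ ~ q s, is_sub G', functional G',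
        forall p (r : R), G (p, r) -> G' (p, s * r)
      & forall p, p \in l -> exists r, G' (p, r)].
  have [G'0 G'D G'Z] := G's.
  have G'tot p : exists r, G' (p, r).
    apply: (lP p (fun p => exists r, G' (p, r))) => //.
    split=> [|u v [r ur] [t vt]|a u [r ur]]; first by exists 0.
      by exists (r + t); apply: G'D ur vt.
    by exists (a *: r); apply: G'Z ur.
  have [g gP] := functional_linear G's G'f G'tot.
  apply/qs/Dq; exists g => p r /GG' G'p.
  by apply/esym/gP.
elim: l {lP} => [|p l [s [G' [qs G's G'f GG' G'l]]]].
  exists 1, G; split=> //; first by case: qp.
  by move=> p r; rewrite mul1r.
have [G'0 G'D G'Z] := G's.
(* The partial map sending a coefficient [c] with [c *: p] in the domain of [G'] to its value. Its
   local extension prescribes the value [r0] at [p], once [G'] is multiplied by [t]. *)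
pose H (u : R^o * R^o) := G' ((u.1 : R) *: p, u.2).
have [||t [r0 [qt tP]]] := @minimal_extension q H qp qx.
- split=> [|u v Hu Hv|a u Hu]; rewrite /H /= ?scale0r //.
    by rewrite scalerDl; apply: G'D Hu Hv.
  by rewrite -scalerA; apply: G'Z Hu.
- by move=> r; rewrite /H /= scale0r => /G'f.
exists (t * s), (fun u => exists p' c r', [/\ G' (p', r'),
  u.1 = p' + c *: p & u.2 = t * r' + c * r0]).
split; first exact: prime_mul_closed.
- split=> [|[u1 u2] [v1 v2] [p1 [c [r1 [G1 /= -> ->]]]]
               [p2 [d [r2 [G2 /= -> ->]]]]
           |a [u1 u2] [p1 [c [r1 [G1 /= -> ->]]]]].
  + by exists 0, 0, 0; split; rewrite // ?scale0r ?addr0 ?mul0r ?mulr0 ?addr0.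
  + exists (p1 + p2), (c + d), (r1 + r2); split; first exact: G'D G1 G2.
      by rewrite scalerDl addrACA.
    by rewrite mulrDl mulrDr addrACA.
  + exists (a *: p1), (a * c), (a *: r1); split; first exact: G'Z G1.
      by rewrite /= scalerDr scalerA.
    by rewrite /= scalerDr /GRing.scale /= mulrCA [a * (c * _)]mulrA.
- move=> r [p' [c [r' [G1 /= /esym/eqP]]]]; rewrite addr_eq0 => /eqP p'E ->.
  have : H (- c, r') by rewrite /H /= scaleNr -p'E.
  by move=> /tP ->; rewrite mulNr addNr.
- move=> p' r /GG' Gp; exists p', 0, (s * r).
  by rewrite scale0r addr0 mul0r addr0 mulrA.
- move=> p'; rewrite inE => /predU1P[->|/G'l[r Gp']].
    by exists r0, 0, 1, 0; rewrite scale1r add0r mulr0 mul1r add0r.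
  exists (t * r), p', 0, r; rewrite scale0r mul0r !addr0.
  by split.
Qed.

(** The annihilator of [p] contains no power of [x], so it lies in a minimal prime, which is the
    annihilator of some nonzero [y]. Hence [a *: p |-> a * y] is well defined, and it extends to [L]
    up to a power of [x]. *)
Lemma torsion_free_torsionless (L : lmodType R) (p : L) :
  fin_gen L -> torsion_free L -> p <> 0 -> exists g : {linear L -> R^o}, g p <> 0.
Proof.
move=> Lfg tfL p0; pose I (a : R^o) := (a : R) *: p = 0.
have Is : is_sub I.
  split=> [|a b Ia Ib|a b Ib]; rewrite /I ?scale0r // ?scalerDl ?Ia ?Ib ?addr0 //.
  by rewrite -scalerA Ib scaler0.
have [W1 WM] := power_closed x.
have [a Ia [n xn]|q [qp Iq qW]] := prime_avoidance nR Is W1 WM.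
  by apply: p0; apply: (torsion_freeX (k := n) tfL); rewrite -xn.
have qx : ~ q x by move=> /qW; apply; exists 1%N.
have [y yP] := minimal_prime_ass qp qx.
have [||n [g gP]] := functional_extension
    (G := fun u => exists a : R, u = (a *: p, a * y : R^o)) Lfg.
- split=> [|_ _ [a ->] [b ->]|b _ [a ->]].
  + by exists 0; rewrite scale0r mul0r.
  + by exists (a + b); rewrite scalerDl mulrDl.
  + by exists (b * a); rewrite -scalerA -mulrA.
- by move=> r [a [/esym Ia ->]]; apply/yP/Iq.
exists g; rewrite (gP p y); last by exists 1; rewrite scale1r mul1r.
move=> /xpow_reg y0; case: qp => _ q1 _; apply: q1; apply/yP.
by rewrite y0 mulr0.
Qed.

(** A functional [u] on the dual of [N] becomes, through restriction of functionals from [P],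
    evaluation at some [p]. Functionals on the torsion-free module P / N vanish at the class of [p],
    so [p] lies in [N]. *)
Lemma reflexive_sub (N P : lmodType R) (f : {linear N -> P}) :
  fin_gen P -> torsion_free P -> injective f ->
  (forall p, (exists n, x *: p = f n) -> exists n, p = f n) ->
  (forall u : {linear {linear P -> R^o} -> R^o}, exists p, forall g, u g = g p) ->
  is_reflexive N.
Proof.
move=> Pfg tfP f_inj f_sat P_surj.
have Nfg : fin_gen N by apply: fin_gen_inj f_inj Pfg.
have tfN : torsion_free N.
  by move=> n xn; apply: f_inj; rewrite linear0; apply: tfP;
    rewrite -linearZ xn linear0.
split=> //; apply: inj_surj_bijective => [n n' nn'|u].
  apply: contrapT => /eqP; rewrite -subr_eq0 => /eqP.
  move=> /(torsion_free_torsionless Nfg tfN)[g]; apply.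
  rewrite linearB; apply/eqP; rewrite subr_eq0; apply/eqP.
  by have := congr1 (fun h : {linear {linear N -> R^o} -> R^o} => h g) nn'.
have pull_linear : linear (fun g : {linear P -> R^o} => u (g \o f)).
  by move=> a g h; rewrite -linearP; congr (u _); apply: lin_ext.
have [v vP] := linearP_ex pull_linear.
have [p pP] := P_surj v.
have Ks : is_sub (fun p => exists n, p = f n).
  split=> [|_ _ [n ->] [n' ->]|a _ [n ->]]; first by exists 0; rewrite linear0.
    by exists (n + n'); rewrite linearD.
  by exists (a *: n); rewrite linearZ.
have [L [h [h_surj hK]]] := quotient_module Ks.
have Lfg : fin_gen L by apply: fin_gen_surj h_surj Pfg.
have tfL : torsion_free L.
  move=> y; have [p' ->] := h_surj y; rewrite -linearZ => /hK/f_sat p'f.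
  exact/hK.
have [n pn] : exists n, p = f n.
  apply/hK; apply: contrapT => /(torsion_free_torsionless Lfg tfL)[g]; apply.
  rewrite -[LHS](pP (g \o h)) vP.
  suff -> : (g \o h \o f : {linear N -> R^o}) = 0 by rewrite linear0.
  by apply: lin_ext => n /=; rewrite (_ : h (f n) = 0) ?linear0 //; apply/hK;
    exists n.
exists n; apply: lin_ext => g; rewrite /bidual /bidual_at /=.
(* A functional on [N] need not extend to [P], but a multiple of it by a power of [x] does, and [x]
   cancels in [R]. *)
have [||k [g' g'P]] := functional_extension
    (G := fun u => exists n, u = (f n, g n)) Pfg.
- split=> [|_ _ [n1 ->] [n2 ->]|a _ [n1 ->]]; first by exists 0; rewrite !linear0.
    by exists (n1 + n2); rewrite !linearD.
  by exists (a *: n1); rewrite !linearZ.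
- move=> r [n' [fn' ->]]; suff -> : n' = 0 by rewrite linear0.
  by apply: f_inj; rewrite -fn' linear0.
have gE : (g' \o f : {linear N -> R^o}) = x ^+ k *: g.
  by apply: lin_ext => n' /=; rewrite (g'P _ (g n')) //; exists n'.
have upg : x ^+ k * (u g - g n : R) = 0.
  rewrite mulrBr -[x ^+ k * g n](g'P p); last by exists n; rewrite pn.
  by rewrite -pP vP gE linearZ subrr.
exact/subr0_eq/(xpow_reg upg).
Qed.

End OneDimensional.

Lemma one_dim_cm (R : comNzRingType) : cm_local_ring R -> krull_dim_eq R 1 ->
  exists (m : R^o -> Prop) (x : R), [/\ is_prime m,
    forall a : R, m a \/ exists b, a * b = 1, m x,
    forall a, x * a = 0 -> a = 0
  & forall p q : R^o -> Prop, is_prime p -> is_prime q ->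
    (forall a, p a -> q a) -> ~ (forall a, q a -> p a) -> forall a, m a -> q a].
Proof.
move=> [nR [I Imax Iuniq] depthR] [dim1 dim2].
have Is := idealr_sub I.
(* A proper ideal containing a non-unit [a] and maximal as such is a maximal ideal, hence [I] by
   uniqueness. *)
have IU (a : R) : a \in I \/ exists b, a * b = 1.
  apply: contrapT => /not_orP[aI aU].
  pose F J := [/\ is_sub J, ~ J 1 & J (a : R^o)].
  have [||J [Js J1 Ja] Jmax] := noetherian_max (F := F)
    (K0 := fun c : R^o => exists d : R, c = a * d) nR (regular_fin_gen R).
  - by move=> K [].
  - split; first exact: principal_sub.
      by move=> [d ad]; apply: aU; exists d.
    by exists 1; rewrite mulr1.
  have [J' JJ'] := idealrP Js J1.
  have J'max : maximal_ideal J'.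
    move=> K J'K c cK; apply/JJ'; apply: Jmax cK.
      by split; [exact: (idealr_sub K)|rewrite /= idealr1|apply/J'K/JJ'].
    by move=> b /JJ'/J'K.
  by apply: aI; rewrite -(Iuniq J' J'max); apply/JJ'.
have Ip : is_prime (fun a : R^o => a \in I).
  split=> //; first by rewrite idealr1.
  move=> a b abI; have [|[a' aa']] := IU a; [by left|right].
  by rewrite -[b]mul1r -aa' [a * a']mulrC -mulrA idealMr.
have [/(_ 1)/eqP|[J Jmax [xs [xs_size xsJ [xs_reg _]]]]] := (depthR 1%N).2 dim1.
  by rewrite oner_eq0.
have xI : xs`_0 \in I by rewrite -(Iuniq J Jmax); apply/xsJ/mem_nth;
  rewrite xs_size.
exists (fun a => a \in I), xs`_0; split=> // [a xa|p q pp qp pq qNp a aI].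
  have [||c ->] := xs_reg 0%N _ a; rewrite ?xs_size ?take0 //=.
    by exists (fun=> 0); rewrite big_ord0.
  by rewrite big_ord0.
(* If [m] were not inside [q], the chain p, q, m would have length two. *)
apply: contrapT => qa; apply: dim2.
have [p' p'P] := prime_idealrP pp; have [q' q'P] := prime_idealrP qp.
have [I' I'P] := prime_idealrP Ip.
exists (fun i => if i is i'.+1 then if i' is i''.+1 then I' else q' else p').
case=> [|[|//]] _; split.
- by move=> b /p'P/pq/q'P.
- by move=> h; apply: qNp => b /q'P/h/p'P.
- move=> b /q'P qb; apply/I'P; have [//|[b' bb']] := IU b.
  by case: (qp) => qs q1 _; case: q1; rewrite -bb'; apply: ideal_mulr.
- by move=> h; apply: qa; apply/q'P/h/I'P.
Qed.

(** * Maximal Cohen-Macaulay modules are the torsion-free ones *)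

Section Nakayama.
Variables (A : comNzRingType) (N : lmodType A) (P : A^o -> Prop).
Hypotheses (nA : noetherian A) (Nfg : fin_gen N) (Pp : is_prime P).

(** Saturated submodules stand for submodules of the localization N_P, so Nakayama's lemma at [P]
    can be stated inside [N]. *)
Definition saturated (K : N -> Prop) :=
  forall (s : A) n, ~ P s -> K (s *: n) -> K n.

(** A maximal proper saturated submodule [L] contains P N: if [a *: n] were outside [L], the
    saturation of L + A a n would be everything, which forces (s - r a) n into [L] with s - r a
    outside [P], and so [n] into [L]. *)
Lemma nakayama (K : N -> Prop) : is_sub K -> saturated K ->
  (forall K', is_sub K' -> (forall n, K n -> K' n) -> saturated K' ->
     (forall (a : A) n, P a -> K' (a *: n)) -> forall n, K' n) ->
  forall n, K n.
Proof.
move=> Ks Ksat KP; apply: contrapT => Kproper.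
pose F K' := [/\ is_sub K', forall n, K n -> K' n, saturated K'
  & ~ forall n, K' n].
have [||L [Ls KL Lsat Lproper] Lmax] := noetherian_max (F := F) (K0 := K) nA Nfg.
- by move=> K' [].
- by split.
apply: Lproper; apply: KP => // a n Pa; apply: contrapT => Lan.
have [L0 LD LZ] := Ls; have [As A1 AM] := Pp; have [P0 PD PZ] := As.
have [_ aD aZ] := adjoin_sub (a *: n) Ls.
pose L' n' := exists2 s : A, ~ P s & adjoin L (a *: n) (s *: n').
apply: (Lan); apply: (Lmax L').
- split.
  + split=> [|u v [s Ps us] [t Pt vt]|b u [s Ps us]].
    * by exists 1; rewrite ?scaler0 //; apply: adjoin_incl.
    * exists (s * t); first exact: prime_mul_closed.
      rewrite scalerDr; apply: aD; first by rewrite mulrC -scalerA; apply: aZ.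
      by rewrite -scalerA; apply: aZ.
    * by exists s; rewrite // scalerA mulrC -scalerA; apply: aZ.
  + by move=> n' /KL Ln'; exists 1; rewrite ?scale1r //; apply: adjoin_incl.
  + move=> s n' Ps [t Pt]; rewrite scalerA => tn'.
    by exists (t * s); first exact: prime_mul_closed.
  + move=> /(_ n)[s Ps [r]]; rewrite scalerA -scalerBl => srn.
    apply: Lan; apply: LZ; apply: Lsat srn => Psr; apply: Ps.
    rewrite -[s](subrK (r * a)); apply: PD => //.
    exact: ideal_mull.
- by move=> n' Ln'; exists 1; rewrite ?scale1r //; apply: adjoin_incl.
- by exists 1; rewrite ?scale1r //; apply: adjoin_gen.
Qed.

Lemma nakayama_principal (a : A) : P a ->
  (forall n : N, exists (s : A) (n' : N), ~ P s /\ s *: n = a *: n') ->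
  forall n : N, exists2 s : A, ~ P s & s *: n = 0.
Proof.
move=> Pa NaN; have [_ P1 _] := Pp; apply: nakayama.
- split=> [|u v [s Ps us] [t Pt vt]|b u [s Ps us]].
  + by exists 1; rewrite ?scaler0.
  + exists (s * t); first exact: prime_mul_closed.
    by rewrite scalerDr mulrC -!scalerA us scalerA mulrC -scalerA vt !scaler0
      addr0.
  + by exists s; rewrite // scalerA mulrC -scalerA us scaler0.
- move=> s n Ps [t Pt]; rewrite scalerA => tn.
  by exists (t * s); first exact: prime_mul_closed.
- move=> K' _ _ K'sat K'P n; have [s [n' [Ps e]]] := NaN n.
  by apply: K'sat Ps _; rewrite e; apply: K'P.
Qed.

End Nakayama.

(** * Primes of a localization *)

Section LocalPrimes.
Variables (B : comNzRingType) (p : prime_idealr B).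
Let W := prime_mulset p.

Lemma contract_prime (q : prime_idealr (ring_at p)) :
  is_prime (fun b : B^o => to_loc W b \in q).
Proof.
split=> [||a b].
- split=> [|a b aq bq|a b bq]; first by rewrite [to_loc _ _]rmorph0 idealr0.
    by rewrite [to_loc _ _]rmorphD rpredD.
  by rewrite [to_loc _ _]rmorphM idealMr.
- by rewrite [to_loc _ _]rmorph1 idealr1.
- by rewrite [to_loc _ _]rmorphM prime_idealrM => /orP.
Qed.

Lemma rfrac_mem (q : idealr (ring_at p)) a s :
  (rfrac a s \in q) = (to_loc W a \in q).
Proof.
have e1 : rfrac a s = rfrac 1 s * to_loc W a.
  by rewrite /to_loc rfracM; apply/rfrac_eq; exists 1;
    rewrite ?rpred1 //= !(mulr1, mul1r).
have e2 : to_loc W a = to_loc W (sval s) * rfrac a s.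
  rewrite /to_loc rfracM; apply/rfrac_eq; exists 1; first exact: rpred1.
  by rewrite /= !mul1r.
by apply/idP/idP => h; [rewrite e2|rewrite e1]; apply: idealMr.
Qed.

Lemma loc_unit a s : a \notin p -> exists y : ring_at p, y * rfrac a s = 1.
Proof.
move=> ap; exists (rfrac (sval s) (exist _ a ap : denom W)); rewrite rfracM.
by apply/rfrac_eq1; exists 1; [exact: rpred1|rewrite /= [a * _]mulrC].
Qed.

Lemma local_mem (q : idealr (ring_at p)) a s : rfrac a s \in q -> a \in p.
Proof.
move=> aq; apply: contraT => /(loc_unit s)[y ys].
by rewrite -(idealr1 q) -ys idealMr.
Qed.

Lemma expand_prime (q : B^o -> Prop) : is_prime q -> (forall b, q b -> b \in p) ->
  exists q' : prime_idealr (ring_at p), forall b s, rfrac b s \in q' <-> q b.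
Proof.
move=> qp qsub; have [[q0 qD qZ] q1 qM] := qp.
pose E (y : (ring_at p)^o) := exists (b : B) (s : denom W), y = rfrac b s /\ q b.
have EP (b : B) (s : denom W) : E (rfrac b s) <-> q b.
  split=> [[c [t [/rfrac_eq[u uW e] qc]]]|qb]; last by exists b, s.
  have /qM[qu|/qM[qt|//]] : q (u * (sval t * b)).
  - by rewrite e; do 2!apply: (qZ _ _).
  - by move: uW; rewrite unfold_in => /negP; case; apply: qsub.
  - have := svalP t; rewrite unfold_in => /negP; case; exact: qsub.
have [|q' q'P] := @prime_idealrP _ E; last by exists q' => b s; rewrite q'P EP.
split=> [||y z].
- split=> [|_ _ [b [s [-> qb]]] [c [t [-> qc]]]|y _ [b [s [-> qb]]]].
  + by exists 0, (denom1 W).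
  + rewrite rfracD; apply/EP; apply: qD; exact: (qZ _ _).
  + have [c [t ->]] := rfracP y; rewrite /GRing.scale /= rfracM; apply/EP.
    exact: (qZ _ _).
- by move=> /(EP 1 (denom1 W)).
- have [b [s ->]] := rfracP y; have [c [t ->]] := rfracP z.
  by rewrite rfracM => /EP/qM[qb|qc]; [left|right]; apply/EP.
Qed.

Lemma local_maximal : exists2 n : idealr (ring_at p), maximal_ideal n
  & forall b s, rfrac b s \in n <-> b \in p.
Proof.
have [//|n nP] := @expand_prime _ (prime_idealr_prime p).
exists (n : idealr _) => // J nJ y; have [b [s ->]] := rfracP y.
by move=> /local_mem bp; apply/nP.
Qed.

End LocalPrimes.

Section MaximalCohenMacaulay.
Variables (B : comNzRingType) (x : B).
Hypotheses (nB : noetherian B) (x_reg : forall a, x * a = 0 -> a = 0).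
Hypothesis height1 : forall p q : B^o -> Prop, is_prime p -> is_prime q ->
  (forall a, p a -> q a) -> ~ (forall a, q a -> p a) -> q x.
Hypothesis no_chain : forall p q r : B^o -> Prop,
  is_prime p -> is_prime q -> is_prime r ->
  (forall a, p a -> q a) -> ~ (forall a, q a -> p a) ->
  (forall a, q a -> r a) -> ~ (forall a, r a -> q a) -> False.

(** A maximal annihilator of an [x]-torsion element is a prime [p] containing [x], and at [p] the
    localization of [N] has depth zero. *)
Lemma MCM_torsion_free (N : lmodType B) : MCM N -> torsion_free x N.
Proof.
move=> [Nfg Ndepth] n0 xn0; apply: contrapT => n0_neq0.
pose ann (n : N) (b : B^o) := (b : B) *: n = 0.
pose F J := exists n, [/\ n <> 0, x *: n = 0 & J = ann n].
have [||_ [n [nn0 xn ->]] nmax] := noetherian_max (F := F) (K0 := ann n0) nB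
  (regular_fin_gen B).
- move=> _ [n [_ _ ->]]; split=> [|a b an bn|a b bn]; rewrite /ann ?scale0r //.
    by rewrite scalerDl an bn addr0.
  by rewrite -scalerA bn scaler0.
- by exists n0.
have annP : is_prime (ann n).
  split=> [||a b abn].
  - split=> [|a b an bn|a b bn]; rewrite /ann ?scale0r //.
      by rewrite scalerDl an bn addr0.
    by rewrite -scalerA bn scaler0.
  - by rewrite /ann scale1r.
  - have [bn|bn] := pselect (b *: n = 0); [by right|left].
    apply: (nmax (ann (b *: n))); last by rewrite /ann scalerA.
      exists (b *: n); split=> //.
      by rewrite scalerA mulrC -scalerA xn scaler0.
    by move=> c cn; rewrite /ann scalerA mulrC -scalerA cn scaler0.
have [p pP] := prime_idealrP annP.
(* Since [x] is a non-zero-divisor, [p] is not minimal, and the localization has dimension at least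
   one. *)
have [k s sn sx|q [qp qn qx]] := @smaller_prime _ nB (ann n) x annP.
  apply: sn; suff -> : s = 0 by rewrite /ann scale0r.
  by apply: (xpow_reg x_reg (n := k)); rewrite mulrC.
have [b /qn/pP //|q' q'P] := expand_prime (p := p) qp.
have [//|p' p'P] := expand_prime (p := p) (prime_idealr_prime p).
have dim1 : krull_dim_ge (ring_at p) 1.
  exists (fun i => if i is 0%N then q' else p'); case=> // _; split.
    move=> y; have [b [s ->]] := rfracP y => /q'P/qn/pP bp; exact/p'P.
  move=> p'q'; apply: qx; apply/(q'P _ (denom1 _))/p'q'/p'P; exact/pP.
have n1 : (Defs.frac n (denom1 _) : module_at p N) <> 0.
  move=> /loc_frac_eq0[u]; rewrite unfold_in => /negP up un.
  by apply/up/pP.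
have [/(_ (Defs.frac n (denom1 _)))/n1 //|[J _ [xs [xs1 yJ [y_reg _]]]]] :=
  Ndepth p 1%N dim1.
(* The element [y] of a regular sequence of length one has its numerator in [p], so it kills the
   nonzero image of [n]. *)
case: xs xs1 yJ y_reg => [|y [|//]] //= _ yJ y_reg.
have {}yJ : y \in J by apply: yJ; rewrite mem_head.
have [b [s yE]] := rfracP y; move: yJ; rewrite yE => /local_mem/pP bn.
case: n1; have [||c ->] := y_reg 0%N _ (Defs.frac n (denom1 _)) => //.
  exists (fun=> 0); rewrite /= big_ord0 yE loc_scaleM bn.
  by apply/loc_frac_eq0; exists 1; rewrite ?rpred1 ?scaler0.
by rewrite big_ord0.
Qed.

Lemma torsion_free_MCM (N : lmodType B) :
  fin_gen N -> torsion_free x N -> MCM N.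
Proof.
move=> Nfg tfN; split=> // p k dimk.
have [|/existsNP[y0 y0_neq0]] := pselect (forall y : module_at p N, y = 0);
  first by left.
right; have [n nmax nP] := local_maximal p; exists n => //.
have [c cP] := dimk; pose ct i := contract_prime (c i).
have ctS i : (i < k)%N ->
    (forall a, to_loc _ a \in c i -> to_loc _ a \in c i.+1) /\
    ~ (forall a, to_loc _ a \in c i.+1 -> to_loc _ a \in c i).
  move=> /cP[ci nci]; split=> [a /ci //|h]; apply: nci => y.
  by have [b [s ->]] := rfracP y; rewrite !rfrac_mem => /h.
(* Length two or more is excluded by [no_chain]; in length one [x] lies in [p] and is itself the
   regular sequence; in length zero the empty sequence serves. *)
case: k dimk cP ctS => [|[|k]] dimk cP ctS; last first.
- have [s01 n01] := ctS 0%N isT; have [s12 n12] := ctS 1%N isT.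
  by case: (no_chain (ct 0%N) (ct 1%N) (ct 2%N)).
- have [s01 n01] := ctS 0%N isT.
  have xp : x \in p.
    by apply: (@local_mem _ p (c 1%N)); apply: (height1 (ct 0%N) (ct 1%N)).
  exists [:: to_loc (prime_mulset p) x]; split=> //.
    by move=> _ /[!inE] /eqP ->; apply/nP.
  split=> [[|//] _ y [d]|].
    rewrite /= big_ord0; have [a [s ->]] := fracP y.
    rewrite /to_loc loc_scaleM => /loc_frac_eq0[u up uxa].
    exists (fun=> 0); rewrite big_ord0; apply/loc_frac_eq0; exists u => //.
    by apply: tfN; rewrite scalerA mulrC -scalerA.
  (* If [x] acted surjectively on N_p, Nakayama's lemma would give N_p = 0. *)
  apply: contrapT => /forallNP xN; apply: y0_neq0.
  have [a [s ->]] := fracP y0; apply/loc_frac_eq0.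
  have [a'|t tp ta] := nakayama_principal nB Nfg (prime_idealr_prime p) xp _ a.
  - have /contrapT[d] := xN (Defs.frac a' (denom1 _)).
    rewrite /= big_ord1 /=; have [b [t ->]] := fracP (d 0%N).
    rewrite /to_loc loc_scaleM => /eq_frac[u up]; rewrite /= !scale1r mul1r.
    rewrite !scalerA => e; exists (u * sval t), (u *: b); split.
      apply/negP; rewrite prime_idealrM negb_or.
      by move: up (svalP t); rewrite !unfold_in => -> ->.
    by rewrite e scalerA mulrC.
  - by exists t => //; rewrite unfold_in; apply/negP.
- exists [::]; split=> //; split=> //; exists y0 => -[d].
  by rewrite big_ord0 => /y0_neq0.
Qed.

End MaximalCohenMacaulay.

(** * Finite birational algebras *)

Lemma noetherian_finite_algebra (R : comNzRingType) (S : comAlgType R) :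
  noetherian R -> @fin_gen R S -> noetherian S.
Proof.
move=> nR Sfin I; apply/fin_genP.
have Is : @is_sub R S (fun s => (s : S^o) \in I).
  split=> [|a b aI bI|r b bI]; first exact: rpred0; first exact: rpredD.
  by have := rpredZ (r%:A : S) bI; rewrite /GRing.scale /= mulr_algl.
have [l [lI Ispan]] := sub_fg nR Sfin Is.
exists (map (insubd (0 : submod I)) l) => u L Ls lL.
have [||v [vu Lv]] := Ispan (val u) (valP u)
  (fun s => exists v : submod I, val v = s /\ L v).
- have [L0 LD LZ] := Ls; split=> [|_ _ [v [<- Lv]] [w [<- Lw]]|r _ [v [<- Lv]]].
  + by exists 0; split; rewrite ?raddf0.
  + by exists (v + w); split; [rewrite raddfD|apply: LD].
  + exists ((r%:A : S) *: v); split; last exact: LZ.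
    by rewrite linearZ /= /GRing.scale /= mulr_algl.
- move=> g gl; exists (insubd (0 : submod I) g); split;
  first by rewrite insubdK //; apply: lI.
  exact/lL/map_f.
by rewrite -(val_inj vu).
Qed.

Section BirationalAlgebra.
Variables (R : comNzRingType) (m : R^o -> Prop) (x : R).
Hypotheses (nR : noetherian R) (mp : is_prime m)
  (mU : forall a : R, m a \/ exists b, a * b = 1) (mx : m x)
  (x_reg : forall a, x * a = 0 -> a = 0).
Hypothesis height1 : forall p q : R^o -> Prop, is_prime p -> is_prime q ->
  (forall a, p a -> q a) -> ~ (forall a, q a -> p a) -> forall a, m a -> q a.
Variables (S : comAlgType R) (e : nat).
Hypotheses (S_fin : @fin_gen R S)
  (x_regS : forall s : S, x *: s = 0 -> s = 0)
  (S_frac : forall s : S, exists r : R, x ^+ e *: s = r%:A).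

Let nS : noetherian S := noetherian_finite_algebra nR S_fin.

Lemma algM (r : R) (s : S) : r%:A * s = r *: s.
Proof. by rewrite mulr_algl. Qed.

Lemma xpow_regS n (s : S) : x ^+ n *: s = 0 -> s = 0.
Proof. exact: (torsion_freeX x_regS). Qed.

Lemma contract_alg (P : S^o -> Prop) :
  is_prime P -> is_prime (fun r : R^o => P (r%:A)).
Proof.
move=> [Ps P1 PM]; have [P0 PD PZ] := Ps; split=> [||a b].
- split=> [|a b Pa Pb|a b Pb]; first by rewrite scale0r.
    by rewrite scalerDl; apply: PD.
  by rewrite -scalerA -algM; apply: ideal_mull.
- by rewrite scale1r.
- by rewrite -scalerA -algM => /PM.
Qed.

Lemma x_radical (P : S^o -> Prop) (r : R) :
  is_prime P -> P x%:A -> m r -> P r%:A.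
Proof.
move=> Pp Px mr; have [n [c rn]] := max_nil_mod_x nR x_reg height1 mr.
apply: (prime_exp (n := n) (contract_alg Pp)).
by rewrite rn -scalerA -algM; apply: ideal_mulr; case: Pp.
Qed.

(** A prime of [S] missing [x] is determined by its contraction, because x^e S lies in [R]; strict
    inclusions below it therefore stay strict in [R]. *)
Lemma height1_alg (p q : S^o -> Prop) : is_prime p -> is_prime q ->
  (forall a, p a -> q a) -> ~ (forall a, q a -> p a) -> q x%:A.
Proof.
move=> pp qp pq nqp; apply: contrapT => qx; apply: (qx).
apply: (height1 (contract_alg pp) (contract_alg qp)) => // [r /pq //|qpc].
apply: nqp => s qs; have [r xs] := S_frac s.
have : p ((x ^+ e)%:A * s).
  by rewrite algM xs; apply: qpc; rewrite -xs -algM; apply: ideal_mull => //;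
    case: qp.
case: (pp) => _ _ pM /pM[/(prime_exp (contract_alg pp))/pq|//].
by move/qx.
Qed.

(* The extension mS of the maximal ideal, as the least R-submodule of S
   containing all products. *)
Definition max_ext (s : S) := forall K : S -> Prop, @is_sub R S K ->
  (forall (r : R) (t : S), m r -> K (r *: t)) -> K s.

Lemma max_ext_sub : @is_sub S S^o max_ext.
Proof.
split=> [K [] //|a b ma mb K Ks mK|a b mb K Ks mK].
  by have [_ KD _] := Ks; apply: KD; [apply: ma|apply: mb].
apply: (mb (fun b => K (a * b))) => [|r t mr].
  have [K0 KD KZ] := Ks; split=> [|u v Ku Kv|r u Ku]; first by rewrite mulr0.
    by rewrite mulrDr; apply: KD.
  by rewrite -scalerAr; apply: KZ.
by rewrite -scalerAr; apply: mK.
Qed.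

Lemma max_ext_gen (r : R) (s : S) : m r -> max_ext (r *: s).
Proof. by move=> mr K _; apply. Qed.

Lemma max_ext_prime (P : S^o -> Prop) : is_prime P ->
  (forall r, m r -> P r%:A) -> forall s, max_ext s -> P s.
Proof.
move=> [[P0 PD PZ] _ _] mP s; apply=> [|r t /mP Pr].
  by split=> // r t Pt; rewrite -algM; apply: (PZ r%:A t).
by rewrite -algM mulrC; apply: (PZ t r%:A).
Qed.

(** The [R]-span of 1, a, ..., a^(n-1), in Horner form. *)
Fixpoint pow_comb (a : S) n : S -> Prop :=
  if n is n'.+1 then fun u => exists (c : R) v,
    pow_comb a n' v /\ u = c%:A + a * v
  else fun u => u = 0.

Lemma pow_comb_sub a n : @is_sub R S (pow_comb a n).
Proof.
elim: n => [|n [IH0 IHD IHZ]]; first exact: zero_sub.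
split=> [|_ _ [c [v [av ->]]] [d [w [aw ->]]]|r _ [c [v [av ->]]]].
- by exists 0, 0; rewrite scale0r mulr0 addr0.
- exists (c + d), (v + w); split; first exact: IHD.
  by rewrite scalerDl mulrDr addrACA.
- exists (r * c), (r *: v); split; first exact: IHZ.
  by rewrite scalerDr scalerA scalerAr.
Qed.

Lemma pow_comb_S a n u : pow_comb a n u -> pow_comb a n.+1 u.
Proof.
elim: n u => [_ ->|n IHn _ [c [v [av ->]]]].
  by exists 0, 0; rewrite scale0r mulr0 addr0.
by exists c, v; split=> //; apply: IHn.
Qed.

Lemma pow_comb_pow a n : pow_comb a n.+1 (a ^+ n).
Proof.
elim: n => [|n IHn]; first by exists 1, 0; rewrite scale1r mulr0 addr0.
by exists 0, (a ^+ n); rewrite scale0r add0r exprS.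
Qed.

(* S / mS is a finite-dimensional algebra over the residue field, hence
   strongly pi-regular. *)
Lemma pi_regular (a : S) : exists (k : nat) (w : S),
  max_ext (a ^+ k - a ^+ k.+1 * w).
Proof.
have [mE0 mED mEZ] := max_ext_sub.
(* An integral equation for [a], obtained below from the ascending chain of these spans. *)
suff [n an] : exists n, pow_comb a n (a ^+ n).
  suff gen k u : pow_comb a n u -> max_ext (a ^+ k * (a ^+ n - u)) ->
      exists (k : nat) (w : S), max_ext (a ^+ k - a ^+ k.+1 * w).
    by apply: (gen 0%N _ an); rewrite subrr mulr0.
  elim: n k u {an} => [|n IHn] k u.
    by move=> ->; rewrite subr0 mulr1 => ak; exists k, 0; rewrite mulr0 subr0.
  (* The lowest coefficient [c] is either in [m], thus negligible modulo mS so that a factor [a]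
     comes out, or a unit, and the relation is solved for [a ^+ k]. *)
  move=> [c [v [av ->]]] h; have [mc|[c' cc']] := mU c.
    apply: (IHn k.+1 v av).
    rewrite (_ : _ * _ = a ^+ k * (a ^+ n.+1 - (c%:A + a * v)) + c *: a ^+ k).
      by apply: mED => //; apply: max_ext_gen.
    by rewrite -algM !exprS; ring.
  exists k, (c'%:A * (a ^+ n - v)).
  rewrite (_ : _ - _ = - c'%:A * (a ^+ k * (a ^+ n.+1 - (c%:A + a * v)))).
    exact: mEZ.
  have e1 : c'%:A * c%:A = 1 :> S by rewrite algM scalerA mulrC cc' scale1r.
  rewrite !exprS; transitivity (a ^+ k * (c'%:A * c%:A) - a * a ^+ k * (c'%:A *
    (a ^+ n - v))).
    by rewrite e1 mulr1.
  by ring.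
have [||_ [n ->] nmax] := noetherian_max (F :=
  fun K => exists n, K = pow_comb a n)
  (K0 := pow_comb a 0) nR S_fin.
- by move=> _ [n ->]; apply: pow_comb_sub.
- by exists 0%N.
exists n; apply: (nmax (pow_comb a n.+1)); last exact: pow_comb_pow.
  by exists n.+1.
exact: pow_comb_S.
Qed.

(** [q] contains [x], hence mS, and a strongly pi-regular domain is a field; so [q] is maximal. *)
Lemma no_chain_alg (p q r : S^o -> Prop) : is_prime p -> is_prime q ->
  is_prime r ->
  (forall a, p a -> q a) -> ~ (forall a, q a -> p a) ->
  (forall a, q a -> r a) -> ~ (forall a, r a -> q a) -> False.
Proof.
move=> pp qp rp pq nqp qr nrq; have qx := height1_alg pp qp pq nqp.
apply: nrq => a ra; have [rs r1 _] := rp; have [qs _ qM] := qp.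
have [k [w aw]] := pi_regular a.
have /qM[/(prime_exp qp)//|/qr r1aw] : q (a ^+ k * (1 - a * w)).
  rewrite mulrBr mulr1 mulrA -exprSr; apply: max_ext_prime aw => // b mb.
  exact: x_radical.
case: r1; rewrite -(subrK (a * w) 1); have [_ rD _] := rs; apply: rD => //.
exact: ideal_mulr.
Qed.

(** Nakayama's lemma over [R], applied to S = uS + mS. *)
Lemma max_ext_unit (u : S) : max_ext (1 - u) -> exists v, u * v = 1.
Proof.
move=> mu; suff [v uv] : exists v, 1 = u * v by exists v.
apply: (nakayama (N := S) (K := fun s => exists v, s = u * v) nR S_fin mp).
- split=> [|_ _ [v ->] [w ->]|r _ [v ->]]; first by exists 0; rewrite mulr0.
    by exists (v + w); rewrite mulrDr.
  by exists (r *: v); rewrite scalerAr.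
- move=> s n ms [v sn]; have [//|[s' ss']] := mU s.
  by exists (s' *: v); rewrite -scalerAr -sn scalerA mulrC ss' scale1r.
- move=> K' K's K'u _ K'm s; rewrite -[s](subrK (u * s)).
  have [_ K'D _] := K's; apply: K'D; last by apply: K'u; exists s.
  rewrite -{1}[s]mul1r -mulrBl.
  have /(_ K' K's) : max_ext ((1 - u) * s).
    by rewrite mulrC; have [_ _ mEZ] := max_ext_sub; apply: (mEZ s (1 - u)).
  by apply=> r t mr; apply: K'm.
Qed.

Lemma max_ext_nil (s : S) : max_ext s ->
  exists (n : nat) (v : S), s ^+ n = x *: v.
Proof.
move=> ms; apply: contrapT => ns; have [W1 WM] := power_closed s.
have [_ [d ->] [n dn]|P [Pp xP Ps]] :=
  prime_avoidance nS (principal_sub (x%:A : S)) W1 WM.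
  by apply: ns; exists n, d; rewrite -dn algM.
apply: (Ps s); last by exists 1%N.
apply: max_ext_prime ms => // r; apply: x_radical => //.
by apply: xP; exists 1; rewrite mulr1.
Qed.

(* Depth one: Hom_S(S / J, S / xS) is nonzero for every proper ideal J. *)
Lemma proper_ideal_socle (J : S^o -> Prop) : is_sub J -> ~ J 1 ->
  exists u : S, ~ (exists v, u = x *: v) /\ forall b : S, J b ->
    exists v, b * u = x *: v.
Proof.
move=> Js J1; have [J0 JD JZ] := Js; have [mE0 mED mEZ] := max_ext_sub.
(* J + mS misses 1 because elements congruent to 1 modulo mS are units; so [J] and mS lie in a
   common prime [n]. *)
have [||||n [np In _]] := @prime_avoidance _
  (fun s : S^o => exists y, max_ext y /\ J (s - y)) (fun s => s = 1) nS.
- split=> [|a b [y [my Jy]] [z [mz Jz]]|a b [y [my Jy]]].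
  + by exists 0; rewrite subr0.
  + exists (y + z); split; first exact: mED.
    by rewrite opprD addrACA; apply: JD.
  + exists (a * y); split; first exact: mEZ.
    by rewrite /GRing.scale /= -mulrBr; apply: ideal_mull.
- by [].
- by move=> _ _ -> ->; rewrite mulr1.
- move=> a [y [my Jy]] a1; rewrite a1 in Jy.
  have [|v yv] := max_ext_unit (u := 1 - y); first by rewrite opprB addrC subrK.
  by apply: J1; rewrite -yv; apply: ideal_mulr.
have [ns n1 nM] := np.
have mn s : max_ext s -> n s by move=> ms; apply: In; exists s; rewrite subrr.
have [_ [d ->]|b nb|u uP] :=
  associated_prime_over (q := n) nS (principal_sub (x%:A : S)) np.
- by apply: mn; rewrite algM; apply: max_ext_gen.
(* b^k (1 - b w) lies in mS, so a power of it lies in xS, while 1 - b w is outside [n]. This makes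
   [n] an associated prime of S / xS. *)
- have [k [w bw]] := pi_regular b.
  have [M [v bM]] := max_ext_nil bw.
  exists (k * M)%N, ((1 - b * w) ^+ M); split.
    move=> /(prime_exp np) nbw; apply: n1; rewrite -(subrK (b * w) 1).
    by case: (ns) => _ nD _; apply: nD => //; apply: ideal_mulr.
  exists v; rewrite algM -bM exprM -exprMn; congr (_ ^+ _).
  by rewrite exprS; ring.
exists u; split=> [[v uv]|b Jb].
  by apply/n1/uP; exists v; rewrite mul1r algM.
have /uP[v bu] : n b by apply: In; exists 0; rewrite subr0.
by exists v; rewrite bu algM.
Qed.

Lemma MCM_alg (N : lmodType S) : MCM N <-> fin_gen N /\ torsion_free (x%:A : S) N.
Proof.
split=> [NCM|[Nfg tfN]].
  split; [by case: NCM|apply: (MCM_torsion_free nS) NCM => s].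
  by rewrite algM => /x_regS.
apply: torsion_free_MCM tfN => //; first exact: height1_alg.
exact: no_chain_alg.
Qed.

End BirationalAlgebra.

(** * Syzygies and reflexivity *)

Section FreeModules.
Variable A : comNzRingType.
Implicit Types M N P : lmodType A.

Lemma row_comb n (v : 'rV[A]_n) : v = \sum_i v 0 i *: delta_mx 0 i.
Proof. exact: row_sum_delta. Qed.

Lemma fin_gen_row n : fin_gen 'rV[A]_n.
Proof.
by exists n, (delta_mx 0) => v; exists (v 0); apply: row_comb.
Qed.

Lemma row_map n P (e : 'I_n -> P) :
  exists f : {linear 'rV[A]_n -> P}, forall v, f v = \sum_i v 0 i *: e i.
Proof.
have [a u v|f fP] := @linearP_ex _ 'rV[A]_n P (fun v => \sum_i v 0 i *: e i).
  rewrite scaler_sumr -big_split; apply: eq_bigr => i _.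
  by rewrite !mxE scalerDl scalerA.
by exists f.
Qed.

Lemma projective_row n : projective 'rV[A]_n.
Proof.
move=> M N g h g_surj.
have /choice[e eP] : forall i, exists y, h (delta_mx 0 i) = g y by [].
have [f fP] := row_map e; exists f => v.
rewrite fP linear_sum {2}[v]row_comb linear_sum; apply: eq_bigr => i _.
by rewrite !linearZ eP.
Qed.

Lemma dual_basis P : fin_gen P -> projective P ->
  exists n (e : 'I_n -> P) (l : 'I_n -> {linear P -> A^o}),
    forall p, p = \sum_i l i p *: e i.
Proof.
move=> [n [e eP]] Pproj; have [f fP] := row_map e.
have [p|h hP] := Pproj _ _ f idfun.
  have [c ->] := eP p; exists (\row_i c i); rewrite fP.
  by apply: eq_bigr => i _; rewrite mxE.
have /choice[l lP] : forall i, exists g : {linear P ->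
  A^o}, forall p, g p = h p 0 i.
  move=> i; have [a p q|g gP] := @linearP_ex _ P A^o (fun p => h p 0 i).
    by rewrite linearP !mxE.
  by exists g.
exists n, e, l => p; rewrite -[LHS](hP p) fP.
by apply: eq_bigr => i _; rewrite lP.
Qed.

Lemma dual_basis_torsion_free (x : A) P n (e : 'I_n -> P)
    (l : 'I_n -> {linear P -> A^o}) :
  (forall a, x * a = 0 -> a = 0) -> (forall p, p = \sum_i l i p *: e i) ->
  torsion_free x P.
Proof.
move=> x_reg lP p xp; rewrite [p]lP big1 // => i _.
suff -> : l i p = 0 by rewrite scale0r.
by apply: x_reg; rewrite -[LHS]/(x *: (l i p)) -linearZ xp linear0.
Qed.

Lemma Omega_CM_embedding (x : A) N n (f : {linear N -> 'rV[A]_n}) :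
  noetherian A ->
  (forall L : lmodType A, fin_gen L -> torsion_free x L -> MCM L) ->
  injective f -> (forall p, (exists k, x *: p = f k) -> exists k, p = f k) ->
  Omega_CM N.
Proof.
move=> nA LCM f_inj f_sat; split; first exact: fin_gen_inj f_inj (fin_gen_row n).
have Ks : is_sub (fun p => exists k, p = f k).
  split=> [|_ _ [k ->] [k' ->]|a _ [k ->]]; first by exists 0; rewrite linear0.
    by exists (k + k'); rewrite linearD.
  by exists (a *: k); rewrite linearZ.
have [L [g [g_surj gK]]] := quotient_module Ks.
exists 'rV[A]_n, L, f, g; split=> //; [exact: fin_gen_row|exact: projective_row|].
apply: LCM; first exact: fin_gen_surj g_surj (fin_gen_row n).
by move=> y; have [p ->] := g_surj y; rewrite -linearZ => /gK/f_sat/gK.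
Qed.

(** The projective module is kept only through a dual basis, and the torsion-free cokernel as
    saturation of the image. *)
Lemma Omega_CM_data (x : A) N :
  (forall a, x * a = 0 -> a = 0) ->
  (forall L : lmodType A, MCM L -> torsion_free x L) -> Omega_CM N ->
  exists (P : lmodType A) (f : {linear N -> P}) n (e : 'I_n -> P)
      (l : 'I_n -> {linear P -> A^o}),
    [/\ fin_gen P, forall p, p = \sum_i l i p *: e i, injective f
      & forall p, (exists k, x *: p = f k) -> exists k, p = f k].
Proof.
move=> x_reg CMtf [Nfg [P [L [f [g [Pfg Pproj LCM [f_inj fg _]]]]]]].
have [n [e [l lP]]] := dual_basis Pfg Pproj.
exists P, f, n, e, l; split=> // p [k xp]; apply/fg/(CMtf L LCM).
by rewrite -linearZ; apply/fg; exists k.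
Qed.

Lemma Omega_CM_torsion_free (x : A) N :
  (forall a, x * a = 0 -> a = 0) ->
  (forall L : lmodType A, MCM L -> torsion_free x L) -> Omega_CM N ->
  torsion_free x N.
Proof.
move=> x_reg CMtf NO.
have [P [f [n [e [l [_ lP f_inj _]]]]]] := Omega_CM_data x_reg CMtf NO.
move=> k xk; apply: f_inj; rewrite linear0.
by apply: (dual_basis_torsion_free x_reg lP); rewrite -linearZ xk linear0.
Qed.

Lemma lin_sumE M N n (c : 'I_n -> A) (g : 'I_n -> {linear M -> N}) p :
  (\sum_i c i *: g i : {linear M -> N}) p = \sum_i c i *: g i p.
Proof.
have ev_lin : linear (fun u : {linear M -> N} => u p) by [].
have [h hP] := linearP_ex ev_lin; rewrite -hP linear_sum.
by apply: eq_bigr => i _; rewrite linearZ hP.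
Qed.

Lemma fin_gen_dual M : noetherian A -> fin_gen M -> fin_gen {linear M -> A^o}.
Proof.
move=> nA [n [g gP]].
have [a u v|f fP] := @linearP_ex _ {linear M ->
  A^o} 'rV[A]_n (fun u => \row_i u (g i)).
  by apply/rowP => i; rewrite !mxE.
apply: (fin_gen_inj (f := f) nA _ (fin_gen_row n)) => u v uv; apply: lin_ext => p.
have [c ->] := gP p; rewrite !linear_sum; apply: eq_bigr => i _.
rewrite !linearZ; congr (_ *: _).
by have := congr1 (fun r : 'rV[A]_n => r 0 i) uv; rewrite !fP !mxE.
Qed.

Lemma reflexive_ev M (u : {linear {linear M -> A^o} -> A^o}) : is_reflexive M ->
  exists p, forall f, u f = f p.
Proof. by move=> [_ [b _ bK]]; exists (b u) => f; rewrite -{1}[u]bK. Qed.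

Lemma reflexive_inj M p q : is_reflexive M ->
  (forall f : {linear M -> A^o}, f p = f q) -> p = q.
Proof. by move=> [_ /bij_inj b_inj] fpq; apply: b_inj; apply: lin_ext => f;
  apply: fpq. Qed.

Lemma mod_iso_sym M N : mod_iso M N -> mod_iso N M.
Proof.
move=> [f [g fK gK]]; have [a u v|h hP] := @linearP_ex _ N M g.
  by apply: (can_inj fK); rewrite linearP !gK.
exists h; exists f => [p|p]; by rewrite hP.
Qed.

End FreeModules.

Section DimensionOne.
Variables (R : comNzRingType) (m : R^o -> Prop) (x : R).
Hypotheses (nR : noetherian R) (mp : is_prime m)
  (mU : forall a : R, m a \/ exists b, a * b = 1) (mx : m x)
  (x_reg : forall a, x * a = 0 -> a = 0).
Hypothesis height1 : forall p q : R^o -> Prop, is_prime p -> is_prime q ->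
  (forall a, p a -> q a) -> ~ (forall a, q a -> p a) -> forall a, m a -> q a.

Lemma MCM_dim1 (N : lmodType R) : MCM N <-> fin_gen N /\ torsion_free x N.
Proof.
split=> [NCM|[Nfg tfN]].
  by split; [case: NCM|apply: (MCM_torsion_free nR) NCM].
apply: torsion_free_MCM tfN => // [p q pp qp pq nqp|p q r pp qp rp pq nqp qr];
  first exact: (height1 pp qp).
by apply=> a /(prime_sub_max mU rp); apply: (height1 pp qp).
Qed.

(** Generators of the dual embed [M] in a free module. The image is saturated: if [x] divides all
    coordinates of [k], evaluation at [k] divided by [x] is an element of the double dual, hence
    comes from [M]. *)
Lemma reflexive_Omega_CM (M : lmodType R) : is_reflexive M -> Omega_CM M.
Proof.
move=> Mref; have [Mfg _] := Mref.
have [n [g gP]] := fin_gen_dual nR Mfg.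
have [a u v|f fP] := @linearP_ex _ M 'rV[R]_n (fun p => \row_i g i p).
  by apply/rowP => i; rewrite !mxE linearP.
have fi p i : f p 0 i = g i p by rewrite fP mxE.
apply: (Omega_CM_embedding (x := x) (f := f)) => //.
- by move=> L Lfg tfL; apply/MCM_dim1.
- move=> p q fpq; apply: (reflexive_inj Mref) => u; have [c ->] := gP u.
  by rewrite !lin_sumE; apply: eq_bigr => i _; rewrite -!fi fpq.
move=> v [k xv].
have /choice[w wP] : forall u : {linear M -> R^o}, exists r : R, x * r = u k.
  move=> u; have [c ->] := gP u; exists (\sum_i c i * v 0 i).
  rewrite lin_sumE mulr_sumr; apply: eq_bigr => i _.
  rewrite -fi -xv mxE; exact: mulrCA.
have x_inj (a b : R) : x * a = x * b -> a = b.
  by move=> ab; apply/subr0_eq/x_reg; rewrite mulrBr ab subrr.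
have [a u u'|W WP] := @linearP_ex _ {linear M -> R^o} R^o w.
  apply: x_inj; rewrite wP.
  have -> : x * (a * w u + w u') = a * (x * w u) + x * w u'.
    by rewrite mulrDr mulrCA.
  by rewrite !wP.
have [p pP] := reflexive_ev W Mref; exists p; apply/rowP => i.
apply: x_inj; rewrite fi -pP WP wP -fi -xv mxE.
by [].
Qed.

Hypothesis R_gG : generically_gorenstein R.

Lemma Omega_CM_reflexive (M : lmodType R) : Omega_CM M -> is_reflexive M.
Proof.
move=> MO; have [L LCM|P [f [n [e [l [Pfg lP f_inj f_sat]]]]]] :=
  Omega_CM_data x_reg _ MO.
  by case/MCM_dim1: LCM.
apply: (reflexive_sub nR mx x_reg height1 R_gG Pfg _ f_inj f_sat).
  exact: dual_basis_torsion_free x_reg lP.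
move=> u; exists (\sum_i u (l i) *: e i) => g.
have gE : g = \sum_i (g (e i) : R) *: l i.
  apply: lin_ext => p; rewrite lin_sumE {1}[p]lP linear_sum.
  by apply: eq_bigr => i _; rewrite linearZ; exact: mulrC.
rewrite {1}gE !linear_sum; apply: eq_bigr => i _.
by rewrite !linearZ; exact: mulrC.
Qed.

End DimensionOne.

(** * The conductor *)

Lemma reflexive_iso (A : comNzRingType) (M N : lmodType A) :
  mod_iso M N -> is_reflexive M -> is_reflexive N.
Proof.
move=> [h [h' hK h'K]] Mref.
have [a u v|k kE] := @linearP_ex _ N M h'.
  by apply: (can_inj hK); rewrite linearP !h'K.
have hk p : h (k p) = p by rewrite kE h'K.
split; first by apply: (fin_gen_surj (g := h)) Mref.1 => p; exists (k p).
apply: inj_surj_bijective => [p q pq|u].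
  rewrite -(hk p) -(hk q); congr (h _); apply: (reflexive_inj Mref) => f0.
  by have := congr1 (fun b : {linear {linear N -> A^o} -> A^o} => b (f0 \o k)) pq.
have [a v w|w wE] := @linearP_ex _ {linear M -> A^o} A^o (fun v => u (v \o k)).
  by rewrite -linearP; congr (u _); apply: lin_ext.
have [p pE] := reflexive_ev w Mref; exists (h p); apply: lin_ext => v.
rewrite /bidual /bidual_at /= -[RHS](pE (v \o h)) wE; congr (u _).
by apply: lin_ext => q /=; rewrite hk.
Qed.

Lemma trace_iso (A : comNzRingType) (M N : lmodType A) a :
  mod_iso M N -> trace N a -> trace M a.
Proof.
move=> [h [k hK kK]] [n [f [p ->]]]; exists n, (fun i => f i \o h), (k \o p).
by apply: eq_bigr => i _ /=; rewrite kK.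
Qed.

Section Conductor.
Variables (R : comNzRingType) (m : R^o -> Prop) (x : R).
Hypotheses (nR : noetherian R) (mp : is_prime m)
  (mU : forall a : R, m a \/ exists b, a * b = 1) (mx : m x)
  (x_reg : forall a, x * a = 0 -> a = 0).
Hypothesis height1 : forall p q : R^o -> Prop, is_prime p -> is_prime q ->
  (forall a, p a -> q a) -> ~ (forall a, q a -> p a) -> forall a, m a -> q a.
Hypothesis R_gG : generically_gorenstein R.
Variables (S : comAlgType R) (e : nat).
Hypotheses (S_fin : @fin_gen R S) (alg_inj : injective (fun r : R => r%:A : S))
  (x_regS : forall s : S, x *: s = 0 -> s = 0)
  (S_frac : forall s : S, exists r : R, x ^+ e *: s = r%:A).

Let nS : noetherian S := noetherian_finite_algebra nR S_fin.
Let xS_reg (s : S) : x%:A * s = 0 -> s = 0.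
Proof. by rewrite algM; apply: x_regS. Qed.
Let MCMS N := MCM_alg nR mU mx x_reg height1 S_fin x_regS S_frac N.

Lemma xe_inj (s t : S) : x ^+ e *: s = x ^+ e *: t -> s = t.
Proof.
by move=> st; apply/subr0_eq/(xpow_regS x_regS (n := e));
  rewrite scalerBr st subrr.
Qed.

(* The conductor of S in R, as an ideal of S. *)
Definition cond (s : S) := forall t : S, exists r : R, s * t = r%:A.

Lemma cond_sub : @is_sub S S^o cond.
Proof.
split=> [t|a b ca cb t|a b cb t]; first by exists 0; rewrite mul0r scale0r.
  have [r ar] := ca t; have [q bq] := cb t.
  by exists (r + q); rewrite mulrDl ar bq scalerDl.
have [r br] := cb (a * t); exists r.
by rewrite -br mulrA [(b : S) * a]mulrC.
Qed.

Lemma cond_alg s : cond s -> exists r : R, s = r%:A.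
Proof. by move=> /(_ 1)[r]; rewrite mulr1; exists r. Qed.

Lemma condM s t : cond s -> cond (t * s).
Proof. exact: (ideal_mull t cond_sub). Qed.

Lemma cond_xe : cond (x ^+ e)%:A.
Proof. by move=> t; rewrite algM; apply: S_frac. Qed.

Lemma alg_functional (M : lmodType R) (f : M -> S) :
  linear f -> (forall p, exists r : R, f p = r%:A) ->
  exists g : {linear M -> R^o}, forall p, (g p : R)%:A = f p.
Proof.
move=> f_lin /choice[g gP]; have [a u v|h hP] := @linearP_ex _ M R^o g.
  by apply: alg_inj; rewrite -gP f_lin !gP scalerDl scalerA.
by exists h => p; rewrite hP gP.
Qed.

(** With [functional_cond], this identifies Hom_R(S, R) with the conductor, through the value at
    1. *)
Lemma cond_functional c : cond c ->
  exists f : {linear S -> R^o}, forall t, (f t : R)%:A = c * t.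
Proof.
move=> cc; apply: alg_functional => // a s t.
by rewrite mulrDr -scalerAr.
Qed.

Lemma restr_functional (N : lmodType S) (f : {linear restr N -> R^o}) (n : N) s :
  (f (s *: n) : R)%:A = s * (f n : R)%:A.
Proof.
apply: xe_inj; have [r sr] := S_frac s.
rewrite scalerAl sr algM !scalerA.
have fZ a (p : restr N) : f (a *: p) = a * f p by rewrite linearZ.
rewrite -!fZ; congr (f _ *: _).
rewrite -[LHS]/((x ^+ e)%:A *: (s *: n)) -[RHS]/(r%:A *: n).
by rewrite scalerA algM sr.
Qed.

Lemma functionalE (f : {linear S -> R^o}) t : (f t : R)%:A = t * (f 1 : R)%:A.
Proof.
apply: xe_inj; have [r tr] := S_frac t.
have fZ a p : f (a *: p) = a * f p by rewrite linearZ.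
by rewrite scalerAl tr algM !scalerA -!fZ tr.
Qed.

Lemma functional_cond (f : {linear S -> R^o}) : cond (f 1 : R)%:A.
Proof. by move=> t; rewrite mulrC -functionalE; exists (f t). Qed.

Definition principal_cond := exists a,
  [/\ cond a, forall s, s * a = 0 -> s = 0 & forall c, cond c ->
    exists s, c = s * a].

Lemma principal_iso : principal_cond -> @mod_iso R S {linear S -> R^o}.
Proof.
move=> [a [ca a_reg aP]].
have /choice[f fP] : forall s, exists f : {linear S -> R^o}, forall t,
    (f t : R)%:A = s * a * t by move=> s; apply/cond_functional/condM.
have [b s t|g gP] := @linearP_ex _ S {linear S -> R^o} f.
  apply: lin_ext => u; apply: alg_inj; rewrite fP.
  transitivity (b *: ((f s u : R)%:A : S) + (f t u : R)%:A); last first.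
    by rewrite scalerA -scalerDl.
  by rewrite !fP !mulrDl -!scalerAl.
exists g; apply: inj_surj_bijective => [s t|u].
  rewrite !gP => /(congr1 (fun f : {linear S -> R^o} => (f 1 : R)%:A : S)).
  rewrite !fP !mulr1 => st; apply/subr0_eq/a_reg.
  by rewrite mulrBl st subrr.
have [s us] := aP _ (functional_cond u); exists s; rewrite gP.
apply: lin_ext => t; apply: alg_inj.
by rewrite functionalE us fP mulrC.
Qed.

Lemma iso_principal : @mod_iso R S {linear S -> R^o} -> principal_cond.
Proof.
move=> [f [g fK gK]].
have fE (s t : S) : (f s t : R)%:A = s * (f 1 t : R)%:A.
  apply: xe_inj; have [r sr] := S_frac s.
  rewrite scalerAl sr algM !scalerA -[x ^+ e * _]/((x ^+ e *: f s) t).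
  have fZ a p : f (a *: p) = a *: f p by rewrite linearZ.
  by rewrite -fZ sr fZ.
exists (f 1 1 : R)%:A; split=> [|s sa|c cc]; first exact: functional_cond.
  apply: (can_inj fK); rewrite linear0; apply: lin_ext => t; apply: alg_inj.
  by rewrite fE functionalE mulrCA sa mulr0 scale0r.
have [u uP] := cond_functional cc; exists (g u).
by rewrite -fE gK uP mulr1.
Qed.

(** Multiplication by [a] is a functional [f] that generates the dual over [S]. An element [u] of
    the double dual is compatible with [S], so [u f] lies in the conductor, equals [s0 * a], and [u]
    is evaluation at [s0]. *)
Lemma principal_reflexive : principal_cond -> @is_reflexive R S.
Proof.
move=> [a [ca a_reg aP]]; split=> //; have [f fP] := cond_functional ca.
apply: inj_surj_bijective => [s t st|u].
  apply/subr0_eq/a_reg; rewrite mulrC mulrBr; apply/eqP; rewrite subr_eq0 -!fP.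
  apply/eqP; congr (_ *: _).
  by have := congr1 (fun b : {linear {linear S -> R^o} -> R^o} => b f) st.
have uE (s : S) (g : {linear S -> R^o}) : (forall t,
  (g t : R)%:A = s * (f t : R)%:A) ->
    (u g : R)%:A = s * (u f : R)%:A.
  move=> gs; apply: xe_inj; have [r sr] := S_frac s.
  rewrite scalerAl sr algM !scalerA.
  have uZ b (h : {linear S -> R^o}) : u (b *: h) = b * u h by rewrite linearZ.
  rewrite -!uZ; congr (u _ *: _); apply: lin_ext => t; apply: alg_inj.
  by rewrite -[LHS]scalerA gs scalerAl sr algM scalerA.
have [s0 us0] : exists s0 : S, (u f : R)%:A = s0 * a.
  apply: aP => s; have [g gP] := cond_functional (condM s ca).
  exists (u g); rewrite mulrC -(uE s g) // => t.
  by rewrite gP fP mulrA.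
exists s0; apply: lin_ext => g; apply: alg_inj; rewrite /bidual /bidual_at /=.
have [s gs] := aP _ (functional_cond g).
rewrite (uE s) ?us0; first by rewrite functionalE gs mulrCA.
by move=> t; rewrite functionalE gs fP mulrCA [t * a]mulrC.
Qed.

(** The conductor is a dual, Hom_R(S, R), and is therefore reflexive. An element [u] of its double
    dual is evaluation at the point corresponding to the value of [u] on the inclusion [f1]. *)
Lemma conductor_module_reflexive (N : lmodType S) (h : {linear N -> S^o}) :
  injective h -> (forall n, cond (h n)) -> (forall s, cond s ->
    exists n, h n = s) ->
  @is_reflexive R (restr N).
Proof.
move=> h_inj hc hC; pose v (n : restr N) : S := h n.
have v_inj : injective v by [].
have vZ (s : S) (n : N) : v (s *: n) = s * v n by rewrite /v linearZ.
have vR (r : R) (n : restr N) : v (r *: n) = r *: v n by rewrite -algM -vZ.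
have vD (n k : restr N) : v (n + k) = v n + v k by rewrite /v linearD.
have vc n : cond (v n) by exact: hc.
have Cv s : cond s -> exists n, v n = s by exact: hC.
clearbody v => {h h_inj hc hC}.
have [a p q|V VP] := @linearP_ex R (restr N) S v; first by rewrite vD vR.
have mu s : exists f : {linear restr N -> R^o}, forall n, (f n : R)%:A = s * v n.
  apply: alg_functional => [a p q|p]; first by rewrite vD vR mulrDr scalerAr.
  by have [r pr] := vc p s; exists r; rewrite mulrC.
split; first by apply: (fin_gen_inj (f := V) nR _ S_fin) => p q;
  rewrite !VP => /v_inj.
have [f1 f1P] := mu 1.
apply: inj_surj_bijective => [p q pq|u].
  have fpq : f1 p = f1 q.
    by apply: (congr1 (fun b : {linear {linear restr N -> R^o} ->
      R^o} => b f1) pq).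
  by apply: v_inj; have := f1P p; rewrite fpq f1P !mul1r.
have uZ b (g : {linear restr N -> R^o}) : u (b *: g) = b * u g by rewrite linearZ.
have uE (s : S) (f : {linear restr N -> R^o}) :
    (forall n, (f n : R)%:A = s * v n) -> (u f : R)%:A = s * (u f1 : R)%:A.
  move=> fs; apply: xe_inj; have [r sr] := S_frac s.
  rewrite scalerAl sr algM !scalerA -!uZ; congr (u _ *: _).
  apply: lin_ext => n; apply: alg_inj.
  by rewrite -[LHS]scalerA fs scalerAl sr algM -[RHS]scalerA f1P mul1r.
have [c0 c0E] : exists c0, v c0 = (u f1 : R)%:A.
  by apply: Cv => s; have [f fP] := mu s; exists (u f); rewrite mulrC -(uE s f).
exists c0; apply: lin_ext => f; rewrite /bidual /bidual_at /=; apply: alg_inj.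
(* [d] corresponds to x^e. By symmetry of [fC], x^e times any functional [f] is [f d] times the
   inclusion, so [u] is known on it. *)
have [d dE] := Cv _ cond_xe.
have fC p q : v p * (f q : R)%:A = v q * (f p : R)%:A.
  rewrite -!restr_functional; congr (f _ *: _); apply: v_inj.
  by rewrite !vZ mulrC.
have fd n : ((x ^+ e *: f) n : R)%:A = (f d : R)%:A * v n.
  by rewrite -[LHS]scalerA -algM -dE fC mulrC.
apply: xe_inj; rewrite -[RHS]algM -dE fC c0E.
by rewrite scalerA -uZ (uE _ _ fd) mulrC.
Qed.

(** * The conductor as an ideal of R *)

Section ConductorIdeal.
Variables (I : submodClosed R^o) (IP : forall r : R,
  (r : R^o) \in I <-> cond r%:A).

Let vI (i : submod I) : S := (val i : R)%:A.

Let vI_cond i : cond (vI i).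
Proof. exact/IP/valP. Qed.

Let vI_inj : injective vI.
Proof. by move=> i k /alg_inj/val_inj. Qed.

Let vID i k : vI (i + k) = vI i + vI k.
Proof. by rewrite /vI raddfD scalerDl. Qed.

Let vIZ (r : R) i : vI (r *: i) = r *: vI i.
Proof. by rewrite /vI linearZ scalerA. Qed.

Let vI_ex c : cond c -> exists i, vI i = c.
Proof.
move=> cc; have [r cr] := cond_alg cc.
have rI : (r : R^o) \in I by apply/IP; rewrite -cr.
by exists (Submod rI).
Qed.

Lemma conductor_mul s :
  exists f : {linear submod I -> submod I}, forall i, vI (f i) = s * vI i.
Proof.
have /choice[g gP] : forall i, exists k, vI k = s * vI i.
  by move=> i; apply/vI_ex/condM/vI_cond.
have [r i k|f fP] := @linearP_ex _ (submod I) (submod I) g.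
  by apply: vI_inj; rewrite vID vIZ !gP vID vIZ mulrDr scalerAr.
by exists f => i; rewrite fP gP.
Qed.

(** An endomorphism of the conductor acts on functionals of [S] through their value at 1, so
    reflexivity makes it multiplication by an element of [S]. Stability thus identifies the
    conductor with [S], and the preimage of the identity generates it. *)
Lemma stable_principal : @is_reflexive R S -> stable_ideal I -> principal_cond.
Proof.
move=> Sref [[b bI b_reg] [th [th' thK th'K]]].
have /choice[mu muP] := conductor_mul.
have homE (f : {linear submod I -> submod I}) : exists s, f = mu s.
  have /choice[g gP] : forall u : {linear S ->
    R^o}, exists i, vI i = (u 1 : R)%:A.
    by move=> u; apply/vI_ex/functional_cond.
  have [a u v|h hP] := @linearP_ex _ {linear S ->
    R^o} R^o (fun u => val (f (g u))).
    have -> : g (a *: u + v) = a *: g u + g v.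
      by apply: vI_inj; rewrite vID vIZ !gP /= scalerDl scalerA.
    rewrite (linearP f).
    exact: (linearP (val : submod I -> R^o)).
  have [s sP] := reflexive_ev h Sref; exists s; apply: lin_ext => i;
    apply: vI_inj.
  have [u uP] := cond_functional (vI_cond i).
  have gu : g u = i by apply: vI_inj; rewrite gP uP mulr1.
  by rewrite muP -[in LHS]gu /vI -hP sP uP mulrC.
pose a := th' idfun.
have aP i : exists s, vI i = s * vI a.
  have [s ths] := homE (th i); exists s; apply: xe_inj; have [r sr] := S_frac s.
  rewrite scalerAl sr algM -!vIZ; congr vI; apply: (can_inj thK).
  rewrite !linearZ /= ths th'K; apply: lin_ext => k; apply: vI_inj.
  by rewrite [LHS]vIZ muP scalerAl sr algM -vIZ.
exists (vI a); split=> [|s sa|c /vI_ex[i <-]]; [exact: vI_cond| |exact: aP].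
(* The regular element [b] is a multiple of the generator, so whatever kills the generator kills
   [b]. *)
have [t bt] := aP (Submod bI); have [r sr] := S_frac s.
have sb : s * b%:A = 0 by rewrite -[b%:A]/(vI (Submod bI)) bt mulrCA sa mulr0.
have rb : r * b = 0.
  apply: alg_inj; rewrite scale0r -scalerA -algM -sr -scalerAl sb.
  by rewrite scaler0.
apply: (xpow_regS x_regS (n := e)); rewrite sr (_ : r = 0) ?scale0r //.
by apply: b_reg; rewrite mulr0 mulrC.
Qed.

Lemma principal_stable : principal_cond -> stable_ideal I.
Proof.
move=> [a [ca a_reg aP]]; have [i0 i0E] := vI_ex ca.
split.
  exists (val i0); first exact: valP.
  move=> b c bc; apply/subr0_eq/alg_inj; rewrite scale0r; apply: a_reg.
  rewrite -i0E /vI algM scalerA; apply/eqP; rewrite mulrC mulrBr bc subrr.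
  by rewrite scale0r.
have /choice[mu muP] := conductor_mul.
have /choice[sg sgP] : forall i, exists s, vI i = s * a by move=> i;
  apply/aP/vI_cond.
have a_inj s t : s * a = t * a -> s = t.
  by move=> st; apply/subr0_eq/a_reg; rewrite mulrBl st subrr.
have [r i k|th thP] := @linearP_ex _ (submod I) {linear submod I -> submod I}
    (fun i => mu (sg i)).
  apply: lin_ext => l; apply: vI_inj.
  have -> : vI ((r *: mu (sg i) + mu (sg k)) l) = r *: vI (mu (sg i) l) +
    vI (mu (sg k) l).
    by rewrite -vIZ -vID.
  rewrite !muP scalerAl -mulrDl; congr (_ * _); apply: a_inj.
  by rewrite mulrDl -scalerAl -!sgP vID vIZ.
exists th; apply: inj_surj_bijective => [i k|f].
  rewrite !thP => /(congr1 (fun f : {linear submod I -> submod I} => vI (f i0))).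
  by rewrite !muP i0E => /a_inj sik; apply: vI_inj; rewrite sgP sik -sgP.
exists (f i0); apply: lin_ext => i; apply: vI_inj; rewrite thP muP.
apply: xe_inj; have [r tr] := S_frac (sg i).
(* After multiplication by x^e every [i] is an [R]-multiple of the generator [i0], so [f] is
   determined by [f i0]. *)
have xi : x ^+ e *: i = r *: i0.
  by apply: vI_inj; rewrite !vIZ sgP scalerAl tr algM i0E.
have fZ (b : R) k : f (b *: k) = b *: f k by rewrite linearZ.
rewrite -vIZ -fZ xi fZ vIZ (sgP (f i0)) (sgP i) -algM -tr -scalerAl.
by congr (_ *: _); rewrite mulrCA.
Qed.

End ConductorIdeal.

Lemma restr_trace (N : lmodType S) r : @trace R (restr N) r -> cond r%:A.
Proof.
move=> [n [f [p ->]]]; have [c0 cD _] := cond_sub.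
elim/big_ind: _ => [|a b ca cb|i _]; first by rewrite scale0r.
  by rewrite scalerDl; apply: cD.
by move=> t; rewrite mulrC -restr_functional; exists (f i (t *: (p i : N))).
Qed.

Lemma restr_linear (N P : lmodType S) (f : {linear N -> P}) :
  exists g : {linear restr N -> restr P}, g =1 f.
Proof. by apply: linearP_ex => a u v; apply: (linearP f a%:A). Qed.

Lemma restr_fin_gen (N : lmodType S) : fin_gen N -> @fin_gen R (restr N).
Proof.
move=> /fin_genP[l lP]; have [k kP] := (fin_genP S).1 S_fin; apply/fin_genP.
exists [seq (s *: n : N) : restr N | s <- k, n <- l] => n L Ls kL.
have [L0 LD LZ] := Ls; rewrite -[n](scale1r (n : N)).
suff /(_ 1) : forall s : S, L (s *: (n : N)) by [].
apply: (lP n (fun n => forall s : S, L (s *: (n : N)))).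
- split=> [s|u v Lu Lv s|t u Lu s]; rewrite ?scaler0 ?scalerDr ?scalerA //.
  exact: LD.
move=> g gl s; apply: (kP s (fun s => L (s *: g))) => [|t tk].
  split=> [|a b La Lb|r a La]; rewrite ?scale0r ?scalerDl //; first exact: LD.
  by rewrite -algM -scalerA; apply: (LZ r).
by apply: kL; apply/allpairsP; exists (t, g).
Qed.

(** A finitely generated projective [S]-module inherits reflexivity over [R] from [S] through a dual
    basis, and [N] is saturated in such a module. *)
Lemma Omega_CM_restr_reflexive (N : lmodType S) :
  @is_reflexive R S -> Omega_CM N -> @is_reflexive R (restr N).
Proof.
move=> Sref NO.
have [L /MCMS[]//|P [f [n [v [l [Pfg lP f_inj f_sat]]]]]] :=
  Omega_CM_data xS_reg _ NO.
have [g gf] := restr_linear f.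
apply: (reflexive_sub (f := g) nR mx x_reg height1 R_gG (restr_fin_gen Pfg)).
- exact: (dual_basis_torsion_free xS_reg lP).
- by move=> p q; rewrite !gf; apply: f_inj.
- by move=> p [k pk]; have [|k' ->] := f_sat p; [exists k;
  rewrite -gf|exists k'; rewrite gf].
move=> u.
have /choice[lR lRP] : forall i, exists h : {linear restr P -> S}, h =1 l i.
  move=> i; apply: linearP_ex => a p q; rewrite -algM.
  exact: (linearP (l i) a%:A).
have /choice[s sP] : forall i, exists s, forall h : {linear S ->
  R^o}, u (h \o lR i) = h s.
  move=> i.
  have [a h h'|w wP] := @linearP_ex _ {linear S ->
    R^o} R^o (fun h => u (h \o lR i)).
    by rewrite -linearP; congr (u _); apply: lin_ext.
  by have [s sP] := reflexive_ev w Sref; exists s => h; rewrite -sP wP.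
exists (\sum_i s i *: v i) => h.
have /choice[k kP] : forall i, exists k : {linear S ->
  R^o}, forall s, k s = h (s *: v i : P).
  move=> i; apply: linearP_ex => a p q.
  by rewrite scalerDl -algM -scalerA; apply: (linearP h a).
have hE : h = \sum_i (k i \o lR i : {linear restr P -> R^o}).
  apply: lin_ext => p; rewrite {1}[p]lP.
  have -> : (\sum_i (k i \o lR i : {linear restr P ->
    R^o})) p = \sum_i k i (lR i p).
    have := lin_sumE (fun=> 1) (fun i => k i \o lR i : {linear restr P -> R^o}) p.
    rewrite (eq_bigr (fun i => (k i \o lR i : {linear restr P -> R^o}))).
      by move=> ->; apply: eq_bigr => i _; rewrite scale1r.
    by move=> i _; rewrite scale1r.
  rewrite (linear_sum h); apply: eq_bigr => i _.
  by rewrite kP lRP.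
rewrite {1}hE (linear_sum u) (linear_sum h); apply: eq_bigr => i _.
by rewrite sP kP.
Qed.

(** All functionals on [M] take values in the conductor S a. Dividing generators of the dual by [a]
    embeds [M] in a free [S]-module. *)
Lemma trace_Omega_CM (M : lmodType R) : principal_cond -> is_reflexive M ->
  (forall r : R, trace M r -> cond r%:A) ->
  exists N : lmodType S, Omega_CM N /\ mod_iso (restr N) M.
Proof.
move=> [a [ca a_reg aP]] Mref Mtr.
have a_inj s t : s * a = t * a -> s = t.
  by move=> st; apply/subr0_eq/a_reg; rewrite mulrBl st subrr.
have Mcond (u : {linear M -> R^o}) p : cond (u p : R)%:A.
  by apply: Mtr; exists 1%N, (fun=> u), (fun=> p); rewrite big_ord1.
have [n [g gP]] := fin_gen_dual nR Mref.1.
pose K (v : 'rV[S]_n) := exists p, forall i, v 0 i * a = (g i p : R)%:A.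
have Ks : is_sub K.
  split=> [|v w [p vp] [q wq]|s v [p vp]].
  - by exists 0 => i; rewrite mxE mul0r linear0 scale0r.
  - by exists (p + q) => i; rewrite mxE mulrDl vp wq linearD scalerDl.
  (* The image is stable under [S]: as [u p] is in the conductor, [u |-> s * u p] has values in [R],
     and reflexivity represents it by an element of [M]. *)
  have [b u w|q|U UP] := @alg_functional {linear M ->
    R^o} (fun u => s * (u p : R)%:A).
  - have -> : ((b *: u + w) p : R)%:A = b *: ((u p : R)%:A : S) + (w p : R)%:A.
      by rewrite scalerA -scalerDl.
    by rewrite mulrDr scalerAr.
  - by have [r rE] := Mcond q p s; exists r; rewrite mulrC.
  have [p' p'P] := reflexive_ev U Mref.
  by exists p' => i; rewrite -p'P UP -vp mxE mulrA.
pose N : lmodType S := submod (to_submod Ks).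
have NK (k : N) : K (val k) by exact/(to_submodP Ks)/valP.
have KN v : K v -> exists k : N, val k = v.
  by move=> Kv; have vN : v \in to_submod Ks by [apply/to_submodP];
    exists (Submod vN).
exists N; split.
  pose f : {linear N -> 'rV[S]_n} := val.
  apply: (Omega_CM_embedding (x := x%:A) (f := f) nS).
  - by move=> L Lfg tfL; apply/MCMS.
  - exact: val_inj.
  move=> v [k kv]; suff /KN[k' k'E] : K v by exists k'.
  have [p pP] := NK k; rewrite -[val k]/(f k) -kv in pP.
  have vcond i : exists r : R, v 0 i * a = r%:A by rewrite mulrC; apply: ca.
  have /choice[r rP] := vcond.
  have xr i : x * r i = g i p.
    by apply: alg_inj; rewrite -pP mxE -mulrA rP algM scalerA.
  have x_inj (b c : R) : x * b = x * c -> b = c.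
    by move=> bc; apply/subr0_eq/x_reg; rewrite mulrBr bc subrr.
  have /choice[w wP] : forall u : {linear M -> R^o}, exists t : R, x * t = u p.
    move=> u; have [c ->] := gP u; exists (\sum_i c i * r i).
    rewrite lin_sumE mulr_sumr; apply: eq_bigr => i _.
    by rewrite -xr; exact: mulrCA.
  have [b u u'|U UP] := @linearP_ex _ {linear M -> R^o} R^o w.
    apply: x_inj; rewrite wP.
    have -> : x * (b * w u + w u') = b * (x * w u) + x * w u'.
      by rewrite mulrDr mulrCA.
    by rewrite !wP.
  have [p' p'P] := reflexive_ev U Mref; exists p' => i.
  rewrite rP -p'P UP; congr (_ *: _); apply: x_inj.
  by rewrite xr wP.
apply: mod_iso_sym.
have /choice[h hP] : forall p, exists k : N, forall i,
  val k 0 i * a = (g i p : R)%:A.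
  move=> p; have /choice[s sP] : forall i, exists s, (g i p : R)%:A = s * a.
    by move=> i; apply: aP.
  have [|k kE] := KN (\row_i s i); first by exists p => i; rewrite mxE -sP.
  by exists k => i; rewrite kE mxE.
have [b p q|H HP] := @linearP_ex _ M (restr N) h.
  apply: val_inj; apply/rowP => i; apply: a_inj; rewrite hP.
  have -> : val (b *: (h p : restr N) + (h q : restr N)) 0 i
      = b *: (val (h p) 0 i) + val (h q) 0 i.
    by rewrite -algM !mxE.
  rewrite mulrDl -scalerAl !hP linearP scalerDl.
  by rewrite scalerA.
exists H; apply: inj_surj_bijective => [p q|k].
  rewrite !HP => hpq; apply: (reflexive_inj Mref) => u; have [c ->] := gP u.
  rewrite !lin_sumE; apply: eq_bigr => i _; congr (_ *: _); apply: alg_inj.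
  by rewrite -!hP hpq.
have [p pP] := NK k; exists p; rewrite HP; apply: val_inj; apply/rowP => i.
by apply: a_inj; rewrite hP pP.
Qed.

Lemma restr_linear_lift (N L : lmodType S) (f : {linear restr N -> restr L}) :
  torsion_free (x%:A : S) L -> exists g : {linear N -> L}, g =1 f.
Proof.
move=> tfL; apply: linearP_ex => s p q.
have fR (r : R) (n : N) : f (r%:A *: n : N) = r%:A *: (f n : L) :> L.
  exact: (linearZ_LR f r).
have fD (n k : N) : f (n + k : N) = (f n : L) + f k :> L by exact: (linearD f).
rewrite fD; congr (_ + _); have [r sr] := S_frac s.
apply/subr0_eq/(torsion_freeX (k := e) tfL).
have xE : (x%:A : S) ^+ e = (x ^+ e)%:A.
  by elim: e => [|k IHk]; rewrite ?scale1r // !exprS IHk algM scalerA.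
by rewrite xE scalerBr -fR !scalerA algM sr fR subrr.
Qed.

(* Modulo a prime containing mS one of [v], [1 - v] vanishes, where
   [v = alpha w], so the glued functional takes one of the two given values. *)
Lemma glue_functionals (N : lmodType S) n (b : 'I_n -> {linear N -> S^o})
    (p : 'I_n -> N) :
  exists (b' : {linear N -> S^o}) (p' : N), forall P : S^o -> Prop, is_prime P ->
    (forall s, max_ext m s -> P s) -> P (b' p') -> P (\sum_i b i (p i)).
Proof.
elim: n b p => [|n IHn] b p.
  by exists \0, 0 => P [[P0 _ _] _ _] _ _; rewrite big_ord0.
have [b' [p' bpP]] := IHn (fun i => b (lift ord0 i)) (fun i => p (lift ord0 i)).
pose alpha : S := b ord0 (p ord0).
have [k [w aw]] := pi_regular nR mU S_fin alpha.
pose v := alpha * w.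
have [bs bsE] : exists bs : {linear N -> S^o},
    forall q, bs q = v * b ord0 q + (1 - v) * b' q :> S.
  by exists (v \*: b ord0 \+ (1 - v) \*: b').
exists bs, (v *: p ord0 + (1 - v) *: p') => P Pp mP.
have [Ps P1 PM] := Pp; have [P0 PD PZ] := Ps.
have -> : bs (v *: p ord0 + (1 - v) *: p')
  = v * (v * alpha + (1 - v) * b ord0 p') + (1 - v) * (v * b' (p ord0) +
    (1 - v) * b' p') :> S.
  by rewrite bsE !linearD !linearZ.
have Pl (s t : S) : P t -> P (s * t) by apply: ideal_mull.
move=> Pd; rewrite big_ord_recl.
(* If [alpha] is in [P], so is [v], and the glued value is [b' p'] modulo [P]; otherwise [1 - v] is
   in [P] and the glued value is [alpha] modulo [P]. *)
have [Pa|Pa] := pselect (P alpha).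
  apply: PD => //; apply: bpP => //.
  have Pv : P v by apply: ideal_mulr.
  rewrite (_ : _ p' = (v * (v * alpha + (1 - v) * b ord0 p')
      + (1 - v) * (v * b' (p ord0) + (1 - v) * b' p'))
    - v * (v * alpha + (1 - v) * b ord0 p' + (1 - v) * b' (p ord0)
           - 2 * (b' p' : S) + v * b' p')); last by ring.
  by apply: (subB Ps) => //; apply: (ideal_mulr _ Ps).
have Pv : P (1 - v).
  have /PM[/(prime_exp Pp)//|//] : P (alpha ^+ k * (1 - v)).
  by rewrite mulrBr mulr1 mulrA -exprSr; apply: mP.
case: Pa; rewrite (_ : alpha = (v * (v * alpha + (1 - v) * b ord0 p')
      + (1 - v) * (v * b' (p ord0) + (1 - v) * b' p'))
    + (1 - v) * ((1 + v) * alpha - v * b ord0 p'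
           - (v * b' (p ord0) + (1 - v) * b' p'))); last by ring.
by apply: PD => //; apply: (ideal_mulr _ Ps).
Qed.

(** If the glued value were not a unit, it would lie together with mS in a prime, which would then
    contain the sum 1. *)
Lemma unimodular_functional (N : lmodType S) n (b : 'I_n -> {linear N -> S^o})
    (p : 'I_n -> N) : \sum_i b i (p i) = 1 ->
  exists (b' : {linear N -> S^o}) (p' : N), b' p' = 1.
Proof.
move=> bp1; have [b' [p' bpP]] := glue_functionals b p; exists b'.
pose I (s : S^o) := exists2 d, max_ext m d & exists t,
  (s : S) - d = (b' p' : S) * t.
have [mE0 mED mEZ] := max_ext_sub m S.
have Is : is_sub I.
  split=> [|s t [d md [u su]] [c mc [v tv]]|s t [d md [u tu]]].
  - by exists 0 => //; exists 0; rewrite mulr0 subr0.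
  - by exists (d + c); [exact: mED|exists (u + v);
    rewrite mulrDr -su -tv opprD addrACA].
  - exists (s * d); first exact: mEZ.
    by exists (s * u); rewrite mulrCA -tu mulrBr.
have [[d md [t dt]]|I1] := pselect (I 1).
  have [|u tu] := max_ext_unit nR mp mU S_fin (u := (b' p' : S) * t).
    by rewrite -dt opprB addrC subrK.
  by exists ((t * u) *: p'); rewrite linearZ -tu -mulrA; exact: mulrC.
have [||a Ia a1|P [Pp IP P1]] := prime_avoidance (W := fun s => s = 1) nS Is.
- by [].
- by move=> _ _ -> ->; rewrite mulr1.
- by apply: I1; rewrite -a1.
exfalso; apply: (P1 1) => //; rewrite -bp1; apply: bpP => // [s ms|]; apply: IP.
  by exists s => //; exists 0; rewrite subrr mulr0.
by exists 0 => //; exists 1; rewrite subr0 mulr1.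
Qed.

(* If the functionals on [N] that extend to a projective overmodule [P] had
   images in a proper ideal, some [u] outside [xS] would satisfy [u N <= x N],
   hence [u / x] would lie in the double dual [S] of [S]. *)
Lemma Omega_CM_principal (N : lmodType S) (h : {linear N -> S^o}) :
  @is_reflexive R S -> Omega_CM N -> injective h ->
  (forall n, cond (h n)) -> (forall s, cond s -> exists n, h n = s) ->
  principal_cond.
Proof.
move=> Sref NO h_inj hc hC.
have [L /MCMS[]//|P [f [k [v [l [Pfg lP f_inj f_sat]]]]]] :=
  Omega_CM_data xS_reg _ NO.
have hZ (s : S) (n : N) : h (s *: n) = s * h n by rewrite linearZ.
have [p lp1] : exists p : 'I_k -> N, \sum_i l i (f (p i)) = 1.
  pose J (s : S^o) := exists p : 'I_k -> N, s = \sum_i l i (f (p i)).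
  apply: contrapT => nJ.
  have [|[p p1]|u [ux uJ]] :=
    proper_ideal_socle nR mp mU mx x_reg height1 S_fin (J := J).
  - split=> [|_ _ [p ->] [q ->]|s _ [p ->]].
    + by exists (fun=> 0); rewrite big1 // => i _; rewrite !linear0.
    + exists (fun i => p i + q i); rewrite -big_split.
      by apply: eq_bigr => i _; rewrite !linearD.
    + exists (fun i => s *: p i); rewrite scaler_sumr.
      by apply: eq_bigr => i _; rewrite !linearZ.
  - by apply: nJ; exists p.
  (* All coordinates of [u *: f n] in the dual basis are divisible by [x]; saturation of [N] in [P]
     brings the quotient back to [N]. *)
  have uN (n : N) : exists n' : N, u *: n = x%:A *: n'.
    have /choice[t tP] : forall i, exists t : S, (l i (f n) : S) * u = x *: t.
      move=> i; apply: uJ; exists (fun j => (j == i)%:R *: n).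
      rewrite (bigD1 i) //= eqxx scale1r big1 ?addr0 // => j /negPf->.
      by rewrite scale0r !linear0.
    have ufn : u *: f n = x%:A *: (\sum_i t i *: v i).
      rewrite scaler_sumr {1}[f n]lP scaler_sumr; apply: eq_bigr => i _.
      by rewrite !scalerA algM -tP mulrC.
    have [|n' n'E] := f_sat (\sum_i t i *: v i).
      by exists (u *: n); rewrite -ufn -linearZ.
    by exists n'; apply: f_inj; rewrite !linearZ -n'E.
  have uC c : cond c -> exists r : R, u * c = (x * r)%:A.
    move=> /hC[n <-]; have [n' n'E] := uN n; have [r rE] := cond_alg (hc n').
    by exists r; rewrite -hZ n'E hZ rE algM scalerA.
  have /choice[w wP] : forall g : {linear S -> R^o}, exists r : R,
      u * (g 1 : R)%:A = (x * r)%:A by move=> g; apply/uC/functional_cond.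
  have x_inj (a c : R) : x * a = x * c -> a = c.
    by move=> ac; apply/subr0_eq/x_reg; rewrite mulrBr ac subrr.
  have [a g g'|W WP] := @linearP_ex _ {linear S -> R^o} R^o w.
    apply/x_inj/alg_inj; rewrite -wP.
    have -> : ((a *: g + g') 1 : R)%:A = a *: ((g 1 : R)%:A : S) + (g' 1 : R)%:A.
      by rewrite scalerA -scalerDl.
    rewrite mulrDr -scalerAr !wP scalerA -scalerDl; congr (_ *: _).
    by rewrite mulrDr mulrCA.
  have [s sP] := reflexive_ev W Sref; apply: ux; exists s.
  have [g gP] := cond_functional cond_xe; apply: xe_inj.
  have := wP g; rewrite -WP sP gP mulr1 -scalerA gP => e1.
  by move: e1; rewrite mulrC !algM => ->; rewrite !scalerA mulrC.
have [b [q bq1]] := unimodular_functional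
  (b := fun i => l i \o f : {linear N -> S^o}) lp1.
(* [N] embeds in [S], where multiplication commutes; with b q = 1 this makes [q] a generator. *)
have hb (n n' : N) : (h n : S) * b n' = (h n' : S) * b n.
  have e1 : (h n : S) *: n' = (h n' : S) *: n.
    by apply: h_inj; rewrite !linearZ; exact: mulrC.
  by have := congr1 b e1; rewrite !linearZ.
exists (h q); split=> [|s sq|_ /hC[n <-]]; first exact: hc.
  have sq0 : s *: q = 0 by apply: h_inj; rewrite linearZ linear0.
  by rewrite -[s]mulr1 -bq1 -[_ * _]/(s *: b q) -linearZ sq0 linear0.
by exists (b n); rewrite mulrC -hb bq1 mulr1.
Qed.

End Conductor.

(** * The four conditions *)

Lemma nonzerodivP (R : comNzRingType) (t : R) :
  reflect (forall a, t * a = 0 -> a = 0) (nonzerodiv t).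
Proof.
apply: (iffP (asboolP _)) => [t_reg a ta|t_reg a b tab].
  by apply: t_reg; rewrite mulr0.
by apply/subr0_eq/t_reg; rewrite mulrBr tab subrr.
Qed.

Lemma regular_to_total_frac (R : comNzRingType) (r : R) (y : total_frac R) :
  (forall a, r * a = 0 -> a = 0) -> to_total_frac R r * y = 0 -> y = 0.
Proof.
move=> r_reg; have [a [s ->]] := rfracP y.
rewrite /to_loc rfracM => /rfrac_eq0[u /nonzerodivP u_reg /u_reg/r_reg ->].
by apply/rfrac_eq0; exists 1; rewrite ?rpred1 ?mulr0.
Qed.

Lemma to_total_frac_inj (R : comNzRingType) : injective (to_total_frac R).
Proof.
move=> a b /rfrac_eq[u /nonzerodivP u_reg]; rewrite /= !mul1r => e.
by apply/subr0_eq/u_reg; rewrite mulrBr e subrr.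
Qed.

Section Embedding.
Variables (R : comNzRingType) (S : comAlgType R) (j : {rmorphism S ->
  total_frac R}).
Hypotheses (j_inj : injective j) (j_R : forall r : R, j r%:A = to_total_frac R r).

Lemma embedding_alg_inj : injective (fun r : R => r%:A : S).
Proof. by move=> a b ab; apply: to_total_frac_inj; rewrite -!j_R ab. Qed.

Lemma embedding_regular (r : R) (s : S) :
  (forall a, r * a = 0 -> a = 0) -> r *: s = 0 -> s = 0.
Proof.
move=> r_reg rs; apply: j_inj; rewrite rmorph0.
apply: (regular_to_total_frac r_reg).
by rewrite -j_R -rmorphM algM rs rmorph0.
Qed.

Lemma embedding_frac (s : S) : exists t r : R,
  (forall a, t * a = 0 -> a = 0) /\ t *: s = r%:A.
Proof.
have [r [t st]] := rfracP (j s); exists (sval t), r; split.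
  exact/nonzerodivP/(svalP t).
apply: j_inj; rewrite -algM rmorphM !j_R st /to_loc rfracM; apply/rfrac_eq.
by exists 1; rewrite ?rpred1 //= !mul1r.
Qed.

Lemma in_conductorP (r : R) : conductor j (to_total_frac R r) <-> cond (r%:A : S).
Proof.
split=> h s; have [q e] := h s; exists q.
  by apply: j_inj; rewrite rmorphM !j_R.
by rewrite -!j_R -e rmorphM.
Qed.

End Embedding.

Theorem theorem3p4 (R : comNzRingType) (S : comAlgType R)
    (j : {rmorphism S -> total_frac R})
    (R_CM : cm_local_ring R) (R_dim : krull_dim_eq R 1)
    (R_gG : generically_gorenstein R)
    (j_inj : injective j) (j_R : forall r : R, j r%:A = to_total_frac R r)
    (S_fin : @fin_gen R S) :
  [<-> (forall M : lmodType R,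
          restr_class (@Omega_CM S) M
          <-> restr_class (@MCM S) M /\ Omega_CM M);
       @mod_iso R S {linear S -> R^o};
       @is_reflexive R S /\ stable_ideal (conductor_ideal j);
       (forall M : lmodType R,
          restr_class (@Omega_CM S) M
          <-> is_reflexive M /\
              forall a : R, trace M a -> conductor j (to_total_frac R a))].
Proof.
have [nR _ _] := R_CM.
have [m [x [mp mU mx x_reg height1]]] := one_dim_cm R_CM R_dim.
have alg_inj := embedding_alg_inj j_R.
have x_regS s := embedding_regular j_inj j_R (s := s) x_reg.
(* Each generator of [S] has a denominator dividing a power of [x]; the exponents add up. *)
have [e S_frac] : exists e, forall s : S, exists r : R, x ^+ e *: s = r%:A.
  have [l lS] := (fin_genP S).1 S_fin.
  suff [e eP] : exists e, forall s, s \in l -> exists r : R, x ^+ e *: s = r%:A.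
    exists e => s; apply: (lS s (fun s => exists r : R,
      x ^+ e *: s = r%:A)) => //.
    split=> [|s1 s2 [r1 e1] [r2 e2]|a s1 [r1 e1]].
    - by exists 0; rewrite scaler0 scale0r.
    - by exists (r1 + r2); rewrite scalerDr e1 e2 scalerDl.
    - by exists (a * r1); rewrite scalerA mulrC -scalerA e1 scalerA.
  elim: l {lS} => [|s l [e eP]]; first by exists 0%N.
  have [t [r [t_reg ts]]] := embedding_frac j_inj j_R s.
  have [n [c xn]] := regular_dvd_xpow nR mx height1 t_reg.
  exists (e + n)%N => s'; rewrite inE exprD => /predU1P[->|/eP[r' e']].
    by exists (x ^+ e * c * r); rewrite xn [t * c]mulrC mulrA -scalerA ts scalerA.
  by exists (x ^+ n * r'); rewrite mulrC -[LHS]scalerA e' scalerA.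
have condP := in_conductorP j_inj j_R.
have IP (r : R) : (r : R^o) \in conductor_ideal j <-> cond (r%:A : S).
  by split=> [/asboolP/condP|/condP h] //; apply/asboolP.
have nS := noetherian_finite_algebra nR S_fin.
have MCMS := MCM_alg nR mU mx x_reg height1 S_fin x_regS S_frac.
have xS_reg (s : S) : x%:A * s = 0 -> s = 0 by rewrite algM; apply: x_regS.
have CMtf (L : lmodType S) : MCM L -> torsion_free (x%:A : S) L by case/MCMS.
have Omega_MCM (N : lmodType S) : Omega_CM N -> MCM N.
  move=> NO; apply/MCMS; split; first by case: NO.
  exact: Omega_CM_torsion_free xS_reg CMtf NO.
have restr_cond (N : lmodType S) M r : mod_iso (restr N) M -> trace M r ->
    conductor j (to_total_frac R r).
  move=> NM Mr; apply/condP; apply: (restr_trace x_regS S_frac (N := N)).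
  exact: trace_iso NM Mr.
split=> [P1|]; last split=> [P2|]; last split=> [[S_ref P3]|P4].
(* [S] is in Omega CM(S) through the identity embedding with zero cokernel, so the first condition
   puts it in Omega CM(R). *)
- have S_ref : @is_reflexive R S.
    apply: (Omega_CM_reflexive nR mU mx x_reg height1 R_gG).
    apply: (proj2 ((P1 S).1 _)); exists S^o; split; last first.
      have [a u v|f fE] := @linearP_ex R (restr (S^o : lmodType S)) S id.
        by rewrite -algM.
      exists f; exists id => s; exact: fE.
    have [a u v|f fE] := @linearP_ex S S^o 'rV[S]_1 (fun s => \row__ s).
      by apply/rowP => i; rewrite !mxE.
    apply: (Omega_CM_embedding (x := x%:A) (f := f) nS).
    + by move=> L Lfg tfL; apply/MCMS.
    + by move=> s t; rewrite !fE => /rowP/(_ 0); rewrite !mxE.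
    + by move=> p _; exists (p 0 0); apply/rowP => i; rewrite fE !ord1 !mxE.
  pose C : lmodType S := submod (to_submod (cond_sub S)).
  pose v : {linear C -> S^o} := val.
  have v_inj : injective v by exact: val_inj.
  have vc (c : C) : cond (v c : S) by exact/(to_submodP (cond_sub S))/valP.
  have cv (s : S) : cond s -> exists c : C, v c = s.
    move=> cs; have sC : (s : S^o) \in to_submod (cond_sub S) by apply/to_submodP.
    by exists (Submod sC).
  clearbody v; clearbody C.
  have tfC : torsion_free (x%:A : S) C.
    by move=> c xc; apply: v_inj; rewrite linear0; apply: xS_reg;
      rewrite -[LHS](linearZ_LR v) xc linear0.
  (* The conductor is torsion-free over [S] and reflexive over [R], so the first condition makes it
     isomorphic over [R] to a member of Omega CM(S). *)
  have [|N [NO [f f_bij]]] := (P1 (restr C)).2.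
    split; last first.
      apply: (reflexive_Omega_CM nR mU mx x_reg height1).
      exact: (conductor_module_reflexive nR S_fin alg_inj x_regS S_frac v_inj
        vc cv).
    exists C; split; last by exists idfun; exists id.
    apply/MCMS; split=> //; apply: (fin_gen_inj nS v_inj).
    exact: regular_fin_gen.
  have [g gE] := restr_linear_lift S_frac f tfC.
  apply: (principal_iso alg_inj x_regS S_frac).
  apply: (Omega_CM_principal nR mp mU mx x_reg height1 S_fin alg_inj x_regS S_frac
    (h := v \o g) S_ref NO).
  + by move=> p q /v_inj; rewrite !gE => /(bij_inj f_bij).
  + by move=> n; apply: vc.
  + move=> s /cv[c <-]; have [f' fK f'K] := f_bij.
    by exists (f' c); rewrite /= gE f'K.
- have P2' := iso_principal alg_inj x_regS S_frac P2; split.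
    exact: (principal_reflexive S_fin alg_inj x_regS S_frac P2').
  exact: (principal_stable alg_inj x_regS S_frac IP P2').
- have P2 := stable_principal alg_inj x_regS S_frac IP S_ref P3.
  move=> M; split=> [[N [NO NM]]|[Mref Mtr]].
    split; last by move=> a; apply: restr_cond NM.
    apply: (reflexive_iso NM).
    exact: (Omega_CM_restr_reflexive nR mU mx x_reg height1 R_gG S_fin x_regS
      S_frac S_ref NO).
  apply: (trace_Omega_CM nR mU mx x_reg height1 S_fin alg_inj x_regS S_frac P2
    Mref).
  by move=> r /Mtr/condP.
(* In both directions Omega CM(R) is traded for Ref(R); the trace condition holds for any module
   with an [S]-structure. *)
- move=> M; split=> [MO|[[N [NCM NM]] MO]].
    have [N [NO NM]] := MO; split; first by exists N; split=> //;
      apply: Omega_MCM.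
    by apply: (reflexive_Omega_CM nR mU mx x_reg height1); case/P4: MO.
  apply/P4; split; last by move=> a; apply: restr_cond NM.
  exact: (Omega_CM_reflexive nR mU mx x_reg height1 R_gG).
Qed.
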